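(* Let $\Pi=\{\pi_n\}$ be the sequence of dyadic partitions $\pi_n=\{iT2^{-n}\}_{i=0}^{2^n}$ of $[0,T]$, let $B$ be an $\mathbb{R}^K$-valued fractional Brownian motion with Hurst index $H\in(\frac13,1)$ and rough path lift $\mathbf{B}$, and let $y$ be a pathwise solution of $$\mathrm{d}y_t=u_t(y_t)\,\mathrm{d}t+\sum_{k=1}^K\sigma_k(y_t;\theta)\,\mathrm{d}\mathbf{B}^k_t.$$ Define for all $n\in\mathbb{N}$ $$H_n=\frac12\Big(1-\frac{\ln S_n}{\ln2}\Big),\qquad\text{where}\qquad S_n=\frac{\langle\langle y\rangle\rangle^{(0),n+1}_T}{\langle\langle y\rangle\rangle^{(0),n}_T}.$$ Then, for every $\epsilon>0$, almost surely, $$H-H_n=\mathcal{O}_C\big(\delta_n^{H-\epsilon}\big),$$ where $\delta_n=2^{-n/2}\sqrt n$ if $H\le\frac12$, $\delta_n=2^{-n(1-H)}\sqrt n$ if $H>\frac12$, and $C=C(T,\|B\|_{H-\epsilon},\|y'\|_{H-\epsilon},[y^\sharp]_{2(H-\epsilon)})$.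
   Context: Scaled variation: with $\delta x_{st}=x_t-x_s$, for $\gamma\in\mathbb{R}$ and scalar $x$, $\langle x\rangle^{(\gamma),n}_t=\sum(t_{i+1}-t_i)^\gamma(\delta x_{t_it_{i+1}})^2$, the sum running over the intervals $[t_i,t_{i+1}]$ of $\pi_n$ contained in $[0,t]$. For $\mathbb{R}^d$-valued $y$, $\langle\langle y\rangle\rangle^{(\gamma),n}=\sum_{i=1}^d\langle y^i\rangle^{(\gamma),n}$. Fractional Brownian motion with Hurst index $H$: centered Gaussian process $B$ with $\mathbb{E}(B_t\otimes B_s)=\frac12(t^{2H}+s^{2H}-|t-s|^{2H})I_{K\times K}$; a.s. $B\in C^\alpha$ for every $\alpha<H$. Rough path lift: $\Delta_T=\{(s,t)\in[0,T]^2:s\le t\}$; $C^\beta_2$ is the set of $f$ on $\Delta_T$ with $[f]_\beta=\sup_{s<t}|f_{st}|/|t-s|^\beta<\infty$. For $\alpha\in(\frac13,\frac12]$ an $\alpha$-Hölder rough path is $(z,\mathbb{Z})\in C^\alpha([0,T];\mathbb{R}^K)\times C^{2\alpha}_2([0,T];\mathbb{R}^{K\times K})$ with $\mathbb{Z}_{st}=\mathbb{Z}_{sr}+\delta z_{sr}\otimes\delta z_{rt}+\mathbb{Z}_{rt}$ for $s\le r\le t$. If $H\in(\frac13,\frac12]$, $\mathbf{B}=(B,\mathbb{B})$, where $\mathbb{B}$ is the a.s. limit in the rough path topology of $\int_s^t\int_s^{t_1}\mathrm{d}B^n_r\otimes\mathrm{d}B^n_{t_1}$ with $B^n$ the piecewise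 linear interpolations of $B$ along dyadic partitions; a.s. $\mathbf{B}$ is an $\alpha$-Hölder rough path for every $\alpha\in(\frac13,H)$. If $H>\frac12$, $\mathbf{B}=B$. Pathwise solution: $\theta\in\Theta$ is a fixed parameter; write $\sigma_k=\sigma_k(\cdot;\theta)$. $u\in C([0,T]\times\mathbb{R}^d;\mathbb{R}^d)$; $\sigma=(\sigma_k)_{1\le k\le K}:\mathbb{R}^d\to\mathbb{R}^{d\times K}$ is of class $C^2$ if $H\le\frac12$ and $C^1$ if $H>\frac12$. A.s., for every $\alpha\in(\frac13,H)$ (every $\alpha\in(\frac12,H)$ if $H>\frac12$), $y\in C^\alpha([0,T];\mathbb{R}^d)$, $\delta y_{st}-\int_s^tu_r(y_r)\mathrm{d}r-\sum_k\sigma_k(y_s)\delta B^k_{st}$ belongs to $C^{2\alpha}_2$, and, if $H\le\frac12$, $\delta y_{st}-\int_s^tu_r(y_r)\mathrm{d}r-\sum_k\sigma_k(y_s)\delta B^k_{st}-\sum_{k,l}\sigma_l[\sigma_k](y_s)\mathbb{B}^{l,k}_{st}$ belongs to $C^{3\alpha}_2$, where $\sigma_l[\sigma_k]^i=\sum_j\sigma_l^j\partial_{x_j}\sigma_k^i$. Notation: $y'=\sigma(y)$ (Gubinelli derivative) and $y^\sharp_{st}=\delta y_{st}-\sum_k\sigma_k(y_s)\delta B^k_{st}$. $\|\cdot\|_\alpha=\|\cdot\|_\infty+[\cdot]_\alpha$ is the $\alpha$-Hölder norm. Convention: $a_n=\mathcal{O}_C(b_n)$ with $C=C(q_1,\dots,q_m)$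 means that there are a finite constant $C$ depending only on $q_1,\dots,q_m$ (and on $\epsilon$ and the fixed exponents and dimensions), and an $n_0$ (possibly random), such that $|a_n|\le C\,|b_n|$ for all $n\ge n_0$.
   Formalization: The rate is claimed only on paths where y'=σ(y) is not identically 0 on [0,T]; otherwise it fails: with σ=0 and u a nonzero constant, S_n=1/2 and H_n=1 for all n, and with u=0 S_n is 0/0. *)

(* Defs.v *)
From mathcomp Require Import all_boot all_order all_algebra.
From mathcomp Require Import all_classical all_reals all_analysis.
Export numFieldNormedType.Exports.

Set Implicit Arguments.
Unset Strict Implicit.
Unset Printing Implicit Defensive.

Import Order.TTheory GRing.Theory Num.Theory.

Local Open Scope classical_set_scope.
Local Open Scope ring_scope.

(* Vectors are column matrices and |.| is the library (sup) norm on matrices.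
   Paths are total functions of t : R; only their values on [0, T] are used. *)

Section Holder.
Context {R : realType} {V : normedModType R}.
Implicit Types (T a : R) (x : R -> V) (f : R -> R -> V).

Definition incr x : R -> R -> V := fun s t => x t - x s.

Definition holder_seminorm2 T a f : \bar R :=
  ereal_sup [set e | exists s t : R,
    [/\ 0 <= s, s < t, t <= T & e = (`|f s t| / (t - s) `^ a)%:E]].

Definition sup_norm T x : \bar R :=
  ereal_sup [set e | exists t : R, [/\ 0 <= t, t <= T & e = `|x t|%:E]].

Definition holder_norm T a x : \bar R :=
  (sup_norm T x + holder_seminorm2 T a (incr x))%E.

Definition holder2 T a f : Prop := (holder_seminorm2 T a f < +oo)%E.
Definition holder T a x : Prop := (holder_norm T a x < +oo)%E.

End Holder.

Section Dyadic.
Context {R : realType}.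
Implicit Types T : R.

Definition dyadic T (n i : nat) : R := i%:R * T / 2 ^+ n.

Definition scaled_variation T (gamma : R) (n : nat) (x : R -> R) (t : R) : R :=
  \sum_(i < 2 ^ n | dyadic T n i.+1 <= t)
     (dyadic T n i.+1 - dyadic T n i) `^ gamma
     * (incr x (dyadic T n i) (dyadic T n i.+1)) ^+ 2.

Definition scaled_variation_vec (d : nat) T (gamma : R) (n : nat)
    (y : R -> 'cV[R]_d) (t : R) : R :=
  \sum_(i < d) scaled_variation T gamma n (fun r => y r i 0) t.

Definition S_ratio (d : nat) T (y : R -> 'cV[R]_d) (n : nat) : R :=
  scaled_variation_vec T 0 n.+1 y T / scaled_variation_vec T 0 n y T.

Definition hurst_estimator (d : nat) T (y : R -> 'cV[R]_d) (n : nat) : R :=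
  2^-1 * (1 - ln (S_ratio T y n) / ln 2).

Definition delta (H : R) (n : nat) : R :=
  if H <= 2^-1 then 2 `^ (- (n%:R / 2)) * Num.sqrt n%:R
  else 2 `^ (- (n%:R * (1 - H))) * Num.sqrt n%:R.

(* For t in [0, T], Num.truncn (t / mesh) is the index i with
   t_i <= t < t_{i+1}; at t = T the slope term has coefficient 0. *)
Definition dyadic_interp (K : nat) T (n : nat) (z : R -> 'cV[R]_K) :
    R -> 'cV[R]_K := fun t =>
  let r := t * 2 ^+ n / T in
  let i := Num.truncn r in
  z (dyadic T n i)
  + (r - i%:R) *: incr z (dyadic T n i) (dyadic T n i.+1).

End Dyadic.

Section FractionalBrownianMotion.
Context {d : measure_display} {Omega : measurableType d} {R : realType}.
Variable P : probability Omega R.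

(* The law is N(m, s^2) or, for variance 0, a Dirac mass: normal_prob m 0 is
   not the Dirac mass at m. *)
Definition gaussian_rv (X : Omega -> R) : Prop :=
  measurable_fun setT X /\
  ((exists m : R, {ae P, forall w, X w = m}) \/
   (exists m s : R, s != 0 /\
      forall A : set R, measurable A -> P (X @^-1` A) = normal_prob m s A)).

Definition centered_gaussian_process (K : nat) (T : R)
    (B : R -> Omega -> 'cV[R]_K) : Prop :=
  (forall (m : nat) (t : 'I_m -> R) (a : 'I_m -> 'I_K -> R),
     (forall i, 0 <= t i <= T) ->
     gaussian_rv (fun w => \sum_(i < m) \sum_(k < K) a i k * B (t i) w k 0)) /\
  (forall t k, 0 <= t <= T -> ('E_P[(fun w => B t w k 0)%R] = 0)%E).

Definition fractional_brownian_motion (K : nat) (T H : R)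
    (B : R -> Omega -> 'cV[R]_K) : Prop :=
  [/\ centered_gaussian_process T B,
      forall (s t : R) (k l : 'I_K), 0 <= s <= T -> 0 <= t <= T ->
        ('E_P[(fun w => B t w k 0 * B s w l 0)%R] =
         (2^-1 * (t `^ (2 * H) + s `^ (2 * H) - `|t - s| `^ (2 * H))
          *+ (k == l))%R%:E)%E
    & {ae P, forall w, forall a : R, 0 < a < H -> holder T a (B ^~ w)}].

End FractionalBrownianMotion.

Section RoughPaths.
Context {R : realType} {K : nat}.
Implicit Types (T a : R) (z : R -> 'cV[R]_K) (Z : R -> R -> 'M[R]_K).

Definition rough_path T a z Z : Prop :=
  [/\ holder T a z, holder2 T (2 * a) Z
    & forall s r t : R, 0 <= s -> s <= r -> r <= t -> t <= T ->
        Z s t = Z s r + incr z s r *m (incr z r t)^T + Z r t].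

Definition rough_dist T a z Z z' Z' : \bar R :=
  (holder_norm T a (fun t => z t - z' t)%R
   + holder_seminorm2 T (2 * a) (fun s t => Z s t - Z' s t)%R)%E.

(* int_s^t int_s^{t1} dz_r (x) dz_{t1} with dz_r = z'(r) dr, for z piecewise
   C^1; the finitely many points without a derivative are Lebesgue-null. *)
Definition smooth_lift z : R -> R -> 'M[R]_K := fun s t =>
  \matrix_(k, l) \int[lebesgue_measure]_(t1 in `[s, t])
     ((\int[lebesgue_measure]_(r in `[s, t1]) derive1 (fun q => z q k 0) r)
      * derive1 (fun q => z q l 0) t1).

End RoughPaths.

Definition rough_lift {R : realType} {d : measure_display}
    {Omega : measurableType d} (P : probability Omega R) (K : nat) (T H : R)
    (B : R -> Omega -> 'cV[R]_K) (BB : R -> R -> Omega -> 'M[R]_K) : Prop :=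
  {ae P, forall w, forall a : R, 3^-1 < a < H ->
    rough_path T a (B ^~ w) (fun s t => BB s t w) /\
    rough_dist T a
      (dyadic_interp T n (B ^~ w)) (smooth_lift (dyadic_interp T n (B ^~ w)))
      (B ^~ w) (fun s t => BB s t w) @[n --> \oo] --> 0%E}.

Section RoughDifferentialEquations.
Context {R : realType} {d K : nat}.
Implicit Types (sigma : 'cV[R]_d -> 'M[R]_(d, K)) (u : R -> 'cV[R]_d -> 'cV[R]_d).

Definition partial (j : 'I_d) (f : 'cV[R]_d -> R) (x : 'cV[R]_d) : R :=
  'D_(delta_mx j 0) f x.

Fixpoint class_C (m : nat) (f : 'cV[R]_d -> R) : Prop :=
  match m with
  | 0 => continuous f
  | m'.+1 => continuous f /\
      forall j : 'I_d, (forall x, derivable f x (delta_mx j 0)) /\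
                       class_C m' (partial j f)
  end.

Definition class_C_mx (m : nat) sigma : Prop :=
  forall i k, class_C m (fun x => sigma x i k).

(* The k-th column of sigma x is sigma_k(x); this is sigma_l[sigma_k](x). *)
Definition vf_bracket sigma (l k : 'I_K) (x : 'cV[R]_d) : 'cV[R]_d :=
  \col_i \sum_(j < d) sigma x j l * partial j (fun z => sigma z i k) x.

Definition drift u (y : R -> 'cV[R]_d) (s t : R) : 'cV[R]_d :=
  \col_i \int[lebesgue_measure]_(r in `[s, t]) (u r (y r) i 0).

(* sigma(y_s) *m dB_st is the sum over k of sigma_k(y_s) dB^k_st. *)
Definition y_sharp sigma (B : R -> 'cV[R]_K) (y : R -> 'cV[R]_d) (s t : R) :
    'cV[R]_d := incr y s t - sigma (y s) *m incr B s t.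

Definition remainder1 u sigma B y (s t : R) : 'cV[R]_d :=
  incr y s t - drift u y s t - sigma (y s) *m incr B s t.

Definition remainder2 u sigma B (BB : R -> R -> 'M[R]_K) y (s t : R) :
    'cV[R]_d :=
  remainder1 u sigma B y s t
  - \sum_(k < K) \sum_(l < K) BB s t l k *: vf_bracket sigma l k (y s).

Definition admissible_coefficients (T H : R) u sigma : Prop :=
  {within [set p : R * 'cV[R]_d | 0 <= p.1 <= T],
     continuous (fun p => u p.1 p.2)} /\
  class_C_mx (if H <= 2^-1 then 2 else 1) sigma.

Definition pathwise_solution {disp : measure_display}
    {Omega : measurableType disp} (P : probability Omega R) (T H : R)
    (B : R -> Omega -> 'cV[R]_K) (BB : R -> R -> Omega -> 'M[R]_K)
    u sigma (y : R -> Omega -> 'cV[R]_d) : Prop :=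
  {ae P, forall w, forall a : R,
    (if H <= 2^-1 then 3^-1 < a < H else 2^-1 < a < H) ->
    [/\ holder T a (y ^~ w),
        holder2 T (2 * a) (remainder1 u sigma (B ^~ w) (y ^~ w))
      & H <= 2^-1 ->
        holder2 T (3 * a)
          (remainder2 u sigma (B ^~ w) (fun s t => BB s t w) (y ^~ w))]}.

End RoughDifferentialEquations.

(* Main.v *)
Require Import Defs.
From mathcomp Require Import all_boot all_order all_algebra.
From mathcomp Require Import all_classical all_reals all_analysis.
From mathcomp Require Import measurable_realfun.
From mathcomp Require Import ring lra.
From HB Require Import structures.

Set Implicit Arguments.
Unset Strict Implicit.
Unset Printing Implicit Defensive.

Import Order.TTheory GRing.Theory Num.Theory.

Local Open Scope classical_set_scope.
Local Open Scope ring_scope.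

(** Write [h = max(1/2, H)], let [D = T 2^-n] be the mesh of the [n]-th dyadic
    grid [t_i = i D], and normalise the variation of [y] by its order of
    magnitude, [A_n = <<y>>_n / (2^n D^(2 H))].  From one grid to the next the
    denominator is multiplied by [2^(1 - 2 H)], hence
      [H - H_n = ln (A_(n+1) / A_n) / (2 ln 2)]
    and the theorem follows once [A_n] stays away from [0] and
    [A_(n+1) - A_n = O(2^-(n (1 - h) p))] for every [p < H]: in both regimes
    [delta_n = 2^-(n (1 - h)) sqrt n], and for [H - eps < p] the random constant
    in the bound is absorbed by the random rank [n0], so that the inequality
    holds with constant [1].

    Three terms make up [A_n] ([variation_decomposition]).

    - Over one interval, [y] differs from its first-order part
      [sigma(y_(t_i)) dB] by the remainder of the equation, of order [D^(2 a)]
      for every admissible [a < H], and by the drift, of order [D].  The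
      contribution of these to [A_n] is [O(D^(a + g - 2 H))] with
      [g = min(1, 2 a)], which is fast enough when [a] is close to [H]
      ([Err_rate]).

    - Replacing [dB^k dB^l] by its mean in [|sigma(y_(t_i)) dB|^2] gives a Riemann
      sum of the Hoelder function [|sigma(y)|^2].  It changes by [O(2^-(n a))] between consecutive
      grids and stays above a positive number as soon as [sigma(y)] is not
      identically [0] ([riemann_sum_step], [riemann_sum_pos]).

    - The fluctuation is a sum of products [dB^k dB^l], centred, with Hoelder
      weights.  Polarisation replaces the products by squares of increments of
      the scalar processes [B^k + B^l] ([product_of_squares]).  The weights are
      frozen on [2^m] blocks with [m] about [n (1 - h)], at a cost of order
      [2^-(m a)].  In one block of [N] increments, with normalised covariances
      [r_ij], the second moment of the sum of centred squares is
      [2 sum_ij r_ij^2] because the increments are jointly Gaussian.  As [r_ij]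
      has a constant sign off the diagonal and [sum_ij r_ij = N^(2 H)] by
      telescoping, this is at most [4 N^(2 h)] ([sum_fgn_cov_sq]).  Summed over
      the blocks, the mean absolute value is [O(2^-(n h (1 - h)))] in relative
      size, which is summable after multiplication by [2^(n (1 - h) p)]; so the
      fluctuations are almost surely [O(2^-(n (1 - h) p))] ([blocksum_rate],
      [weighted_square_rate]). *)

(** * Moments of Gaussian variables *)

Section RealIntegrable.
Context {R : realType} {d : measure_display} {T : measurableType d}.
Variables (mu : {measure set T -> \bar R}).

Lemma integrable_realD (f g : T -> R) :
  mu.-integrable setT (EFin \o f) -> mu.-integrable setT (EFin \o g) ->
  mu.-integrable setT (EFin \o (fun x => f x + g x)).
Proof.
move=> fi gi; apply: (@eq_integrable _ _ _ mu setT measurableT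
  ((EFin \o f) \+ (EFin \o g))%E) => //.
exact: integrableD.
Qed.

Lemma integrable_realZ (a : R) (f : T -> R) :
  mu.-integrable setT (EFin \o f) ->
  mu.-integrable setT (EFin \o (fun x => a * f x)).
Proof.
move=> fi; apply: (@eq_integrable _ _ _ mu setT measurableT
  (fun x => a%:E * (EFin \o f) x)%E) => //.
exact: integrableZl.
Qed.

End RealIntegrable.

Section GaussMoments.
Context {R : realType}.
Local Notation mu := (@lebesgue_measure R).
Local Notation g := (@gauss_fun R).

Let gE x : g x = expR (- x ^+ 2). Proof. by []. Qed.

(** The cubic majorant covers every antiderivative below at once. *)
Lemma gauss_fun_decay (x : R) : 1 <= x -> (x ^+ 3 + x + 1) * g x <= 12 / x.
Proof.
move=> x1; have x0 : 0 < x by lra.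
have : 1 + x ^+ 4 / 2 <= expR (x ^+ 2).
  have := expR_ge1Dxn 1 (sqr_ge0 x).
  by rewrite -exprM (_ : (2`!)%:R = 2).
rewrite gE expRN => h.
have e0 := expR_gt0 (x ^+ 2).
rewrite ler_pdivrMr// mulrAC ler_pdivlMr//.
apply: (@le_trans _ _ (12 * (1 + x ^+ 4 / 2))); last by rewrite ler_pM2l.
have : x^+2 <= x ^+ 4 by rewrite ler_weXn2l.
have : x <= x ^+ 4 by rewrite -[leLHS]expr1 ler_weXn2l.
nra.
Qed.

Lemma cvg_poly_gauss (F : R -> R) :
  (forall x, 1 <= x -> `|F x| <= (x ^+ 3 + x + 1) * g x) -> F x @[x --> +oo] --> 0.
Proof.
move=> hF; apply/cvgrPdist_le => e e0; near=> x.
have x1 : 1 <= x by near: x; exact: nbhs_pinfty_ge.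
rewrite sub0r normrN (le_trans (hF x x1))// (le_trans (gauss_fun_decay x1))//.
rewrite ler_pdivrMr ?(lt_le_trans ltr01)// mulrC -ler_pdivrMr//.
Unshelve. all: by end_near. Qed.

Lemma is_derive_gauss (x : R) : is_derive x 1 g (- 2 * x * g x).
Proof.
rewrite /gauss_fun; apply: is_derive_eq.
rewrite /GRing.scale/=. 
ring.
Qed.

Let Ihalf (F : R -> R) := (\int[mu]_(x in `[0%R, +oo[) (F x)%:E)%E.

(** The fundamental theorem on an unbounded interval is used for a nonnegative
    integrand; the moments below are computed by adding to the wanted integrand
    a term with known integral that makes it nonnegative. *)
Lemma half_line_FTC (f F : R -> R) (l : R) :
  (forall x, 0 <= x -> 0 <= f x) -> continuous f ->
  (forall x : R, is_derive x 1 F (f x)) ->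
  F x @[x --> +oo] --> l -> Ihalf f = (l - F 0)%:E.
Proof.
move=> f0 cf dF Fl; rewrite /Ihalf (@ge0_continuous_FTC2y _ f F 0 l) ?EFinB//.
- exact: continuous_subspaceT.
- apply/cvg_at_right_filter/differentiable_continuous/derivable1_diffP.
  exact: ex_derive.
- by move=> x _; rewrite derive1E derive_val.
Qed.


#[local] Existing Instance is_derive_gauss.

Let contXg (n : nat) : continuous (fun x : R => x ^+ n * g x).
Proof.
by move=> x; apply: cvgM; [exact: exprn_continuous|exact: continuous_gauss_fun].
Qed.

Lemma Ihalf_id : Ihalf (fun x => x * g x) = (2^-1)%:E.
Proof.
have -> : Ihalf (fun x => x * g x) = (0 - - (2^-1) * g 0)%:E.
  apply: (@half_line_FTC _ (fun x => - (2^-1) * g x) 0).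
  - by move=> x x0; rewrite mulr_ge0 ?gauss_fun_ge0.
  - by move=> x; apply: cvgM; [exact: cvg_id|exact: continuous_gauss_fun].
  - move=> x; apply: is_derive_eq; rewrite /GRing.scale/=.
    by field.
  - apply: cvg_poly_gauss => x x1; have g0 := gauss_fun_ge0 x.
    rewrite normrM [`|g x|]ger0_norm// normrN ger0_norm// ler_wpM2r//.
    have : 0 <= x ^+ 3 by rewrite exprn_ge0; lra.
    lra.
by rewrite gE expr0n/= oppr0 expR0; congr EFin; field.
Qed.

Lemma Ihalf_expR : Ihalf (fun x => expR (- x)) = 1%:E.
Proof.
have -> : Ihalf (fun x => expR (- x)) = (0 - - expR (- 0))%:E.
  apply: (@half_line_FTC _ (fun x => - expR (- x)) 0).
  - by move=> x x0; rewrite expR_ge0.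
  - by move=> x; apply: continuous_comp; [exact: opp_continuous|exact: continuous_expR].
  - move=> x; apply: is_derive_eq; rewrite /GRing.scale/=.
    by ring.
  - by rewrite -oppr0; apply: cvgN; exact: cvgr_expR.
by rewrite oppr0 expR0; congr EFin; ring.
Qed.

Let half_sqrtpi : R := Num.sqrt pi / 2.
Lemma Ihalf_gauss : Ihalf (fun x => g x) = half_sqrtpi%:E.
Proof. exact: integral0y_gauss. Qed.

Let mXg (n : nat) : measurable_fun (`[0, +oo[ : set R) (fun x : R => x ^+ n * g x).
Proof.
apply/measurable_funTS; apply: continuous_measurable_fun.
exact: contXg.
Qed.

Lemma Ihalf_sq : Ihalf (fun x => x ^+ 2 * g x) = (2^-1%:E * Ihalf (fun x => g x))%E.
Proof.
(* The derivative of - x g(x) / 2 is negative near 0, where the second term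
   compensates for it. *)
pose f x := (x ^+ 2 - 2^-1) * g x + expR (- x).
have e14 (x : R) : expR (- x ^+ 2) <= 2 * expR (- x).
  have : 3 / 4 <= expR (x ^+ 2 - x).
    apply: le_trans (expR_ge1Dx _).
    by have := sqr_ge0 (x - 2^-1); nra.
  move=> h; rewrite (_ : - x ^+ 2 = - x - (x ^+ 2 - x)); last by ring.
  rewrite expRB ler_pdivrMr ?expR_gt0//.
  have := ler_wpM2l (expR_ge0 (- x)) h.
  by have := expR_gt0 (- x); lra.
have f0 x : 0 <= x -> 0 <= f x.
  move=> x0; rewrite /f; have := e14 x; rewrite -gE => h.
  have : 0 <= x ^+ 2 * g x by rewrite mulr_ge0 ?gauss_fun_ge0// sqr_ge0.
  by nra.
have cf : continuous f.
  move=> x; apply: cvgD; last first.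
    by apply: continuous_comp; [exact: opp_continuous|exact: continuous_expR].
  apply: cvgM; last exact: continuous_gauss_fun.
  by apply: cvgB; [exact: exprn_continuous|exact: cvg_cst].
have Kf : Ihalf f = 1%:E.
  have -> : Ihalf f = (0 - (- (2^-1) * 0 * g 0 - expR (- 0)))%:E.
    apply: (@half_line_FTC _ (fun x => - (2^-1) * x * g x - expR (- x)) 0) => //.
    - move=> x; apply: is_derive_eq; rewrite /GRing.scale/= /f.
      by field.
    - rewrite -[X in _ --> X](subrr 0); apply: cvgB; last exact: cvgr_expR.
      apply: cvg_poly_gauss => x x1; have g0 := gauss_fun_ge0 x.
      rewrite 2!normrM [`|g x|]ger0_norm// normrN (@ger0_norm _ x); last lra.
      rewrite ger0_norm//.
      rewrite ler_wpM2r//.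
      have : 0 <= x ^+ 3 by rewrite exprn_ge0; lra.
      lra.
  by rewrite oppr0 expR0; congr EFin; ring.
have : (Ihalf f + (2^-1)%:E * Ihalf (fun x => g x) = Ihalf (fun x => (x ^+ 2 * g x)%R) + Ihalf (fun x => expR (- x)%R))%E.
  have m0 : measurable_fun (`[0, +oo[ : set R) (fun x : R => g x).
    by apply: measurable_funTS; exact: measurable_gauss_fun.
  have m2 := mXg 2.
  have me : measurable_fun (`[0, +oo[ : set R) (fun x : R => expR (- x)).
    by apply: measurable_funTS; apply: measurableT_comp.
  have mf : measurable_fun (`[0, +oo[ : set R) f.
    by apply: measurable_funTS; exact: continuous_measurable_fun.
  rewrite /Ihalf -ge0_integralZl//; last 2 first.
    exact/measurable_EFinP.
    by move=> x _; rewrite lee_fin gauss_fun_ge0.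
  rewrite -!ge0_integralD//.
  - apply: eq_integral => x _; rewrite -!EFinM -!EFinD; congr EFin.
    by rewrite /f; ring.
  - by move=> x _; rewrite lee_fin mulr_ge0 ?gauss_fun_ge0 ?sqr_ge0.
  - exact/measurable_EFinP.
  - exact/measurable_EFinP.
  - by move=> x /=; rewrite in_itv/= andbT => x0; rewrite lee_fin f0.
  - exact/measurable_EFinP.
  - by move=> x _; rewrite lee_fin mulr_ge0 ?gauss_fun_ge0.
  - by apply/measurable_EFinP; apply: measurable_funM.
rewrite Kf Ihalf_expR Ihalf_gauss; case: (Ihalf (fun x => x ^+ 2 * g x)) => [r| |]//= [h].
by congr EFin; move: h; lra.
Qed.

Lemma Ihalf_pow4 : Ihalf (fun x => x ^+ 4 * g x) = ((3 / 2)%:E * Ihalf (fun x => (x ^+ 2 * g x)%R))%E.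
Proof.
(* The derivative of - (x^3 + 1) g(x) / 2; the constant 1 makes it nonnegative. *)
pose f x := (x ^+ 4 - 3 / 2 * x ^+ 2 + x) * g x.
have f0 x : 0 <= x -> 0 <= f x.
  move=> x0; rewrite /f mulr_ge0 ?gauss_fun_ge0//.
  suff : 0 <= x * (x ^+ 3 - 3 / 2 * x + 1) by lra.
  rewrite mulr_ge0//.
  have : 0 <= (x - 3/4) ^+ 2 * (x + 3/2) by rewrite mulr_ge0 ?sqr_ge0//; lra.
  by lra.
have cf : continuous f.
  move=> x; apply: cvgM; last exact: continuous_gauss_fun.
  apply: cvgD; last exact: cvg_id.
  apply: cvgB; first exact: exprn_continuous.
  by apply: cvgM; [exact: cvg_cst|exact: exprn_continuous].
have Kf : Ihalf f = (2^-1)%:E.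
  have -> : Ihalf f = (0 - (- (2^-1) * (0 ^+ 3 + 1) * g 0))%:E.
    apply: (@half_line_FTC _ (fun x => - (2^-1) * (x ^+ 3 + 1) * g x) 0) => //.
    - move=> x; apply: is_derive_eq; rewrite /GRing.scale/= /f.
      by field.
    - apply: cvg_poly_gauss => x x1; have g0 := gauss_fun_ge0 x.
      have x3 : 0 <= x ^+ 3 by rewrite exprn_ge0; lra.
      rewrite 2!normrM [`|g x|]ger0_norm// normrN (@ger0_norm _ (_ + _)); last lra.
      rewrite ger0_norm//.
      rewrite ler_wpM2r//.
      lra.
  by rewrite gE !expr0n/= oppr0 expR0; congr EFin; field.
have : (Ihalf f + (3/2)%:E * Ihalf (fun x => (x ^+ 2 * g x)%R) = Ihalf (fun x => (x ^+ 4 * g x)%R) + Ihalf (fun x => (x * g x)%R))%E.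
  have m2 := mXg 2; have m4 := mXg 4.
  have m1 : measurable_fun (`[0, +oo[ : set R) (fun x : R => x * g x) := mXg 1.
  have mf : measurable_fun (`[0, +oo[ : set R) f.
    by apply: measurable_funTS; exact: continuous_measurable_fun.
  rewrite /Ihalf -ge0_integralZl//; last 2 first.
    exact/measurable_EFinP.
    by move=> x _; rewrite lee_fin mulr_ge0 ?gauss_fun_ge0 ?sqr_ge0.
  rewrite -!ge0_integralD//.
  - apply: eq_integral => x _; rewrite -!EFinM -!EFinD; congr EFin.
    by rewrite /f; ring.
  - by move=> x _; rewrite lee_fin mulr_ge0 ?gauss_fun_ge0// (exprM x 2 2) sqr_ge0.
  - exact/measurable_EFinP.
  - by move=> x /=; rewrite in_itv/= andbT => x0; rewrite lee_fin mulr_ge0// gauss_fun_ge0.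
  - exact/measurable_EFinP.
  - by move=> x /=; rewrite in_itv/= andbT => x0; rewrite lee_fin f0.
  - exact/measurable_EFinP.
  - move=> x _; rewrite lee_fin; have := mulr_ge0 (sqr_ge0 x) (gauss_fun_ge0 x); lra.
  - by apply/measurable_EFinP; apply: measurable_funM.
rewrite Kf Ihalf_id Ihalf_sq Ihalf_gauss; case: (Ihalf (fun x => x ^+ 4 * g x)) => [r| |]//= [h].
by congr EFin; move: h; lra.
Qed.

Local Notation Iline F := (\int[mu]_x (F x)%:E)%E.
Let sqrtpi : R := Num.sqrt pi.

Lemma IhalfE (F : R -> R) :
  (\int[mu]_(x in [set x | (0 <= x)%R]) (F x)%:E)%E = Ihalf F.
Proof.
rewrite /Ihalf; congr (integral _ _ _).
by apply/seteqP; split => x/=; rewrite in_itv/= andbT.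
Qed.

Lemma Iline_gauss : Iline (fun x => g x) = sqrtpi%:E. Proof. exact: integralT_gauss. Qed.

Lemma Iline_abs : Iline (fun x => `|x| * g x) = 1%:E.
Proof.
rewrite ge0_symfun_integralT.
- rewrite IhalfE (_ : Ihalf _ = Ihalf (fun x => x * g x)).
    by rewrite Ihalf_id -EFinM; congr EFin; field.
  apply: eq_integral => x; rewrite inE/= in_itv/= andbT => x0.
  by rewrite ger0_norm.
- by move=> x; rewrite mulr_ge0// gauss_fun_ge0.
- by move=> x; apply: cvgM; [exact: norm_continuous|exact: continuous_gauss_fun].
- by move=> x; rewrite /= normrN !gE sqrrN.
Qed.

(** Compared with [Iline_abs], this says that the first moment vanishes, while
    only nonnegative functions are integrated. *)
Lemma Iline_absD : Iline (fun x => (`|x| + x) * g x) = 1%:E.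
Proof.
rewrite (_ : Iline _ = Ihalf (fun x => (2 * x) * g x)).
  have m1 : measurable_fun (`[0, +oo[ : set R) (fun x : R => x * g x) := mXg 1.
  rewrite /Ihalf; under eq_integral do rewrite -mulrA EFinM.
  rewrite ge0_integralZl//.
  - by rewrite -/(Ihalf (fun x => x * g x)) Ihalf_id -EFinM; congr EFin; field.
  - exact/measurable_EFinP.
  - by move=> x /=; rewrite in_itv/= andbT => x0; rewrite lee_fin mulr_ge0// gauss_fun_ge0.
rewrite /Ihalf [RHS]integral_mkcond; apply: eq_integral => x _.
rewrite patchE; case: ifPn.
  rewrite inE/= in_itv/= andbT => x0.
  by rewrite ger0_norm//; congr EFin; ring.
rewrite notin_setE/= in_itv/= andbT => /negP; rewrite -ltNge => x0.
by rewrite ltr0_norm// addNr mul0r.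
Qed.

Lemma Iline_even (n : nat) : Iline (fun x => x ^+ n.*2 * g x) = (2%:E * Ihalf (fun x => (x ^+ n.*2 * g x)%R))%E.
Proof.
rewrite ge0_symfun_integralT ?IhalfE//.
- by move=> x; rewrite mulr_ge0 ?gauss_fun_ge0// -mul2n exprM exprn_ge0// sqr_ge0.
- by move=> x /=; rewrite !gE sqrrN -mul2n !exprM sqrrN.
Qed.

Lemma Iline_sq : Iline (fun x => x ^+ 2 * g x) = (sqrtpi / 2)%:E.
Proof.
by rewrite (Iline_even 1) Ihalf_sq Ihalf_gauss -!EFinM; congr EFin; rewrite /half_sqrtpi /sqrtpi; field.
Qed.

Lemma Iline_pow4 : Iline (fun x => x ^+ 4 * g x) = (3 / 4 * sqrtpi)%:E.
Proof.
by rewrite (Iline_even 2) Ihalf_pow4 Ihalf_sq Ihalf_gauss -!EFinM; congr EFin; rewrite /half_sqrtpi /sqrtpi; field.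
Qed.

Let mg : measurable_fun [set: R] (fun x : R => g x).
Proof. exact: measurable_gauss_fun. Qed.

Lemma integrable_gauss : mu.-integrable setT (EFin \o (fun x => g x)).
Proof. exact: integrableT_gauss. Qed.

Lemma integrable_abs_gauss : mu.-integrable setT (EFin \o (fun x => `|x| * g x)).
Proof.
apply/integrableP; split.
  by apply/measurable_EFinP; apply: measurable_funM => //; exact: measurableT_comp.
under eq_integral do rewrite /= ger0_norm ?mulr_ge0 ?gauss_fun_ge0//.
by rewrite Iline_abs ltry.
Qed.

Lemma integrable_id_gauss : mu.-integrable setT (EFin \o (fun x => x * g x)).
Proof.
apply: le_integrable integrable_abs_gauss => //.
  by apply/measurable_EFinP; exact: measurable_funM.
by move=> x _ /=; rewrite lee_fin !normrM normr_id.
Qed.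

Lemma Rintegral_id_gauss : \int[mu]_x (x * g x) = 0.
Proof.
have h1 : \int[mu]_x (`|x| * g x) = 1 by rewrite /Rintegral Iline_abs.
have h2 : \int[mu]_x ((`|x| + x) * g x) = 1 by rewrite /Rintegral Iline_absD.
move: h2; under eq_Rintegral do rewrite mulrDl.
rewrite RintegralD//.
- by rewrite h1 -[RHS]addr0 => /addrI.
- exact: integrable_abs_gauss.
- exact: integrable_id_gauss.
Qed.

(** The normal law is defined by a density, so by uniqueness its Radon-Nikodym
    derivative is that density almost everywhere. *)
Lemma ge0_integral_normal_prob (m s : R) (f : R -> R) :
  s != 0 -> measurable_fun setT f -> (forall x, 0 <= f x) ->
  (\int[normal_prob m s]_x (f x)%:E = \int[mu]_x (f x * normal_pdf m s x)%:E)%E.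
Proof.
move=> s0 mf f0.
have dom := normal_prob_dominates m s.
rewrite -(Radon_Nikodym_SigmaFinite.change_of_variables dom) //; last exact/measurable_EFinP.
have RNi := Radon_Nikodym_SigmaFinite.f_integrable dom.
apply: ae_eq_integral => //.
- apply: emeasurable_funM => //; first exact/measurable_EFinP.
  exact: (measurable_int mu).
- apply/measurable_EFinP; apply: measurable_funM => //.
  exact: measurable_normal_pdf.
- under [X in ae_eq _ _ _ X]eq_fun do rewrite EFinM.
  apply: ae_eqe_mul2l.
  apply: integral_ae_eq => //.
  + apply/measurable_EFinP; exact: measurable_normal_pdf.
  + by move=> E _ mE; rewrite -Radon_Nikodym_SigmaFinite.f_integral.
Qed.

Lemma integral_normal_prob_gauss (m s : R) (G : R -> R) :
  s != 0 -> continuous G -> (forall x, 0 <= G x) ->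
  let c := Num.sqrt (s ^+ 2 *+ 2) in
  (\int[normal_prob m s]_x (G x)%:E = (normal_peak s * c)%:E * Iline (fun x => (G (c * x + m) * g x)%R))%E.
Proof.
move=> s0 cG G0 c; have c0 : 0 < c by rewrite sqrtr_gt0 pmulrn_lgt0// exprn_even_gt0.
have mG := continuous_measurable_fun cG.
have F'E : (fun x : R => c * x + m)^`()%classic = cst c.
  by apply/funext => x; rewrite derive1E derive_val /GRing.scale/= mulr1 addr0.
(* This form exhibits the limits of the change of variables at infinity. *)
have FE : (fun x : R => c * x + m) = (fun x => (x + m / c) * c).
  by apply/funext => x; field; rewrite gt_eqF.
rewrite ge0_integral_normal_prob//.
rewrite (@increasing_ge0_integration_by_substitutionT _ (fun x => c * x + m)).
- rewrite -ge0_integralZl//.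
  + apply: eq_integral => x _; rewrite F'E -EFinM/=; congr EFin.
    rewrite /= /normal_pdf (negbTE s0) /normal_fun.
    change (G (c * x + m) * (normal_peak s * expR (- (c * x + m - m) ^+ 2 / (s ^+ 2 *+ 2))) * c
      = normal_peak s * c * (G (c * x + m) * g x)).
    rewrite addrK !gE.
    rewrite (_ : - (c * x) ^+ 2 / (s ^+ 2 *+ 2) = - x ^+ 2); first by ring.
    rewrite exprMn sqr_sqrtr ?pmulrn_lge0 ?sqr_ge0//.
    by field.
  + apply/measurable_EFinP; apply: measurable_funM => //.
    by apply: measurableT_comp => //; apply: measurable_funD => //; apply: measurable_funM.
  + by move=> x _; rewrite lee_fin mulr_ge0// gauss_fun_ge0.
  + by rewrite lee_fin mulr_ge0 ?normal_peak_ge0// ltW.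
- by move=> x y xy; rewrite ltrD2r ltr_pM2l.
- by rewrite F'E => ?; exact: cvg_cst.
- by rewrite F'E; exact: is_cvg_cst.
- by rewrite F'E; exact: is_cvg_cst.
- by move=> x; exact: ex_derive.
- rewrite FE; apply/gt0_cvgMlNy => //; exact: cvg_addrr_Ny.
- rewrite FE; apply/gt0_cvgMly => //; exact: cvg_addrr.
- by move=> x; apply: cvgM; [exact: cG|exact: (continuous_normal_pdf s0)].
- by move=> x; rewrite mulr_ge0// normal_pdf_ge0.
Qed.

Section Law.
Context {d : measure_display} {Omega : measurableType d}.
Variable P : probability Omega R.
Variable X : Omega -> R.
Hypothesis mX : measurable_fun setT X.
Variables m s : R.
Hypothesis s0 : s != 0.
Hypothesis lawX : forall A : set R, measurable A -> P (X @^-1` A) = normal_prob m s A.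

Let c := Num.sqrt (s ^+ 2 *+ 2).
Let kappa := (normal_peak s * c).

Lemma integral_law (G : R -> R) : continuous G -> (forall x, 0 <= G x) ->
  (\int[P]_w (G (X w))%:E = kappa%:E * Iline (fun x => (G (c * x + m) * g x)%R))%E.
Proof.
move=> cG G0; rewrite -integral_normal_prob_gauss//.
have mX' : measurable_fun setT (X : Omega -> measurableTypeR R) := mX.
pose X' := isMeasurableFun.Build _ _ _ (measurableTypeR R) (X : Omega -> measurableTypeR R) mX'.
pose Xm : {mfun Omega >-> measurableTypeR R} := HB.pack (X : Omega -> measurableTypeR R) X'.
rewrite -[LHS](@ge0_integral_distribution _ _ _ _ _ P Xm (fun x => (G x)%:E)).
- by apply: eq_measure_integral => A mA _; exact: lawX.
- by apply/measurable_EFinP; exact: continuous_measurable_fun.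
- by move=> x; rewrite lee_fin.
Qed.

(** The constant is found without computing it, by taking [G = 1]. *)
Lemma law_mass : kappa * sqrtpi = 1.
Proof.
have c1 : continuous (fun _ : R => 1 : R) by move=> x; exact: cvg_cst.
have h := integral_law c1 (fun=> ler01).
have L1 : Iline (fun x => (1 * g x)%R) = sqrtpi%:E.
  by rewrite -Iline_gauss; apply: eq_integral => x _; rewrite mul1r.
have P1 : (\int[P]_w 1%:E = 1)%E.
  by rewrite integral_cst// mul1e; exact: probability_setT.
have {h} : (1 = kappa%:E * sqrtpi%:E :> \bar R)%E by rewrite -P1 -L1; exact: h.
by rewrite -EFinM => -[].
Qed.

Let c0 : 0 < c. Proof. by rewrite sqrtr_gt0 pmulrn_lgt0// exprn_even_gt0. Qed.

Let int_affine : mu.-integrable setT (EFin \o (fun x => c * (x * g x) + m * g x)).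
Proof.
apply: integrable_realD; apply: integrable_realZ.
- exact: integrable_id_gauss.
- exact: integrable_gauss.
Qed.

Let int_absaffine : mu.-integrable setT (EFin \o (fun x => `|c * x + m| * g x)).
Proof.
apply: le_integrable int_affine => //.
  apply/measurable_EFinP; apply: measurable_funM => //.
  by apply: measurableT_comp => //; apply: measurable_funD => //; apply: measurable_funM.
by move=> x _ /=; rewrite lee_fin mulrA -mulrDl !normrM normr_id.
Qed.

Lemma law_integrable : P.-integrable setT (EFin \o X).
Proof.
apply/integrableP; split; first exact/measurable_EFinP.
rewrite (integral_law (@norm_continuous _ R) (fun x => normr_ge0 x)).
have /integrableP[_] := int_absaffine.
under eq_integral do rewrite /= ger0_norm ?mulr_ge0 ?gauss_fun_ge0//.
move=> h; rewrite lte_mul_pinfty//.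
by rewrite lee_fin mulr_ge0 ?normal_peak_ge0// ltW.
Qed.

(** [|X| + X] and [|X|] are nonnegative, so both means can be computed by
    [integral_law]; their difference is the mean of [X]. *)
Lemma law_mean : \int[P]_w X w = m.
Proof.
have iX := law_integrable.
have iaX : P.-integrable setT (EFin \o (fun w => `|X w|)).
  by have := integrable_abse iX.
have l1 : \int[P]_w `|X w| = kappa * \int[mu]_x (`|c * x + m| * g x).
  rewrite /Rintegral (integral_law (@norm_continuous _ R) (fun x => normr_ge0 x)).
  by rewrite fineM//; exact: integrable_fin_num int_absaffine.
have cG : continuous (fun x : R => `|x| + x).
  by move=> x; apply: cvgD; [exact: norm_continuous|exact: cvg_id].
have G0 (x : R) : 0 <= `|x| + x.
  by rewrite -lerBlDr sub0r -normrN ler_norm.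
have int2 : mu.-integrable setT (EFin \o (fun x => `|c * x + m| * g x + (c * (x * g x) + m * g x))).
  exact: integrable_realD.
have l2 : \int[P]_w (`|X w| + X w) = kappa * (\int[mu]_x (`|c * x + m| * g x) + m * sqrtpi).
  transitivity (fine (kappa%:E * Iline (fun x => (`|c * x + m| * g x + (c * (x * g x) + m * g x))%R))%E).
    rewrite /Rintegral (integral_law cG G0); congr (fine (_ * _)%E).
    by apply: eq_integral => x _; congr EFin; ring.
  rewrite fineM//; last exact: integrable_fin_num int2.
  congr (_ * _).
  transitivity (\int[mu]_x (`|c * x + m| * g x + (c * (x * g x) + m * g x))) => //.
  have i1 : mu.-integrable setT (EFin \o (fun x => c * (x * g x))).
    by apply: integrable_realZ; exact: integrable_id_gauss.
  have i2 : mu.-integrable setT (EFin \o (fun x => m * g x)).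
    by apply: integrable_realZ; exact: integrable_gauss.
  rewrite RintegralD//; congr (_ + _).
  rewrite RintegralD//.
  rewrite (RintegralZl c measurableT integrable_id_gauss) Rintegral_id_gauss mulr0 add0r.
  rewrite (RintegralZl m measurableT integrable_gauss).
  by rewrite /Rintegral Iline_gauss.
move: l2; rewrite RintegralD// l1 mulrDr => /addrI ->.
by rewrite mulrCA law_mass mulr1.
Qed.

Hypothesis m0 : m = 0.

Let Iline_affine (n : nat) : (forall x : R, 0 <= x ^+ n) ->
  Iline (fun x => ((c * x + m) ^+ n * g x)%R) =
  ((c ^+ n)%:E * Iline (fun x => (x ^+ n * g x)%R))%E.
Proof.
move=> n0; rewrite -ge0_integralZl//.
- by apply: eq_integral => x _; rewrite -EFinM m0 addr0 exprMn mulrA.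
- by apply/measurable_EFinP; apply: measurable_funM => //.
- by move=> x _; rewrite lee_fin mulr_ge0 ?gauss_fun_ge0.
- by rewrite lee_fin.
Qed.

Lemma law_sq : (\int[P]_w (X w ^+ 2)%:E = (s ^+ 2)%:E)%E.
Proof.
have c2 : continuous (fun x : R => x ^+ 2) by exact: exprn_continuous.
rewrite (integral_law c2 (fun x => sqr_ge0 x)) Iline_affine; last exact: sqr_ge0.
rewrite Iline_sq -!EFinM; congr EFin.
rewrite sqr_sqrtr ?pmulrn_lge0 ?sqr_ge0//.
by transitivity (s ^+ 2 * (kappa * sqrtpi)); [field|rewrite law_mass mulr1].
Qed.

Lemma law_pow4 : (\int[P]_w (X w ^+ 4)%:E = (3 * s ^+ 4)%:E)%E.
Proof.
have c4 : continuous (fun x : R => x ^+ 4) by exact: exprn_continuous.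
have p4 (x : R) : 0 <= x ^+ 4 by rewrite (exprM x 2 2) sqr_ge0.
rewrite (integral_law c4 p4) Iline_affine// Iline_pow4 -!EFinM; congr EFin.
rewrite (exprM c 2 2) sqr_sqrtr ?pmulrn_lge0 ?sqr_ge0//.
by transitivity (3 * s ^+ 4 * (kappa * sqrtpi)); [field|rewrite law_mass mulr1].
Qed.

End Law.

End GaussMoments.

Section GaussianVariables.
Context {R : realType} {d : measure_display} {Omega : measurableType d}.
Variable P : probability Omega R.

(** The degenerate Gaussian law is a Dirac mass, which centring puts at [0]. *)
Lemma gaussian_fourth_moment (X : Omega -> R) :
  gaussian_rv P X -> ('E_P[X] = 0)%E ->
  P.-integrable setT (EFin \o (fun w => X w ^+ 4)) /\
  \int[P]_w (X w ^+ 4) = 3 * (\int[P]_w (X w ^+ 2)) ^+ 2.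
Proof.
move=> [mX [[m Xm]|[m [s [s0 lawX]]]]] EX0.
- have m0 : m = 0.
    move: EX0; rewrite unlock => h; apply: EFin_inj.
    transitivity (\int[P]_w (X w)%:E)%E; last exact: h.
    rewrite (@ae_eq_integral _ _ _ P setT (cst m%:E))//.
    + rewrite integral_cst//= [X in (_ * X)%E](_ : _ = 1%E) ?mule1//.
      exact: probability_setT.
    + exact/measurable_EFinP.
    + by apply: filterS Xm => w /= ->.
  have ae_n n : ae_eq P setT (EFin \o (fun w => X w ^+ n.+1)) (cst 0%E).
    by apply: filterS Xm => w /= ->; rewrite m0 expr0n.
  have mXn n : measurable_fun setT (EFin \o (fun w => X w ^+ n)).
    by apply/measurable_EFinP; exact: measurable_funX.
  have i0 n : (\int[P]_w (X w ^+ n.+1)%:E = 0)%E.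
    transitivity (\int[P]_w (cst 0%E w))%E; last exact: integral0.
    by apply: ae_eq_integral => //; [exact: mXn|exact: ae_n].
  split; last by rewrite /Rintegral !i0/= expr0n mulr0.
  apply/integrableP; split => //.
  rewrite (_ : integral _ _ _ = 0%E)//.
  transitivity (\int[P]_w (cst 0%E w))%E; last exact: integral0.
  apply: ae_eq_integral => //; first exact: measurableT_comp.
  by apply: filterS (ae_n 3%N) => w /= h; move=> /h [->]; rewrite normr0.
- have m0 : m = 0.
    rewrite -(law_mean mX s0 lawX) /Rintegral.
    by move: EX0; rewrite unlock => h; transitivity (fine (0%E : \bar R)); first congr fine.
  have h2 := law_sq mX s0 lawX m0.
  have h4 := law_pow4 mX s0 lawX m0.
  split; last first.
    by rewrite /Rintegral h2 h4/= -exprM.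
  apply/integrableP; split.
    by apply/measurable_EFinP; exact: measurable_funX.
  under eq_integral do rewrite /= ger0_norm ?(exprM _ 2 2) ?sqr_ge0//.
  by under eq_integral do rewrite -exprM; rewrite h4 ltry.
Qed.

End GaussianVariables.

(** * Products of jointly Gaussian variables *)

Section RealExpectation.
Context {R : realType} {d : measure_display} {Omega : measurableType d}.
Variable P : probability Omega R.
Local Notation Int f := (P.-integrable setT (EFin \o f)).
Local Notation Ex f := (Rintegral P setT f).

Lemma integrable_real_cst (a : R) : Int (fun=> a).
Proof. exact: finite_measure_integrable_cst. Qed.

Lemma Rexpectation_cst (a : R) : Ex (fun=> a) = a.
Proof.
rewrite Rintegral_cst// [X in fine X](_ : _ = 1%E) ?mulr1//.
exact: probability_setT.
Qed.

Lemma RexpectationD (f g : Omega -> R) : Int f -> Int g ->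
  Ex (fun w => f w + g w) = Ex f + Ex g.
Proof. by move=> fi gi; rewrite RintegralD. Qed.

Lemma RexpectationZ (a : R) (f : Omega -> R) : Int f ->
  Ex (fun w => a * f w) = a * Ex f.
Proof. by move=> fi; rewrite RintegralZl. Qed.

Lemma integrable_real_sum (I : Type) (s : seq I) (f : I -> Omega -> R) :
  (forall i, Int (f i)) -> Int (fun w => \sum_(i <- s) f i w).
Proof.
move=> fi; elim: s => [|i s IH].
  by under eq_fun do rewrite big_nil; exact: integrable_real_cst.
under eq_fun do rewrite big_cons.
exact: integrable_realD.
Qed.

Lemma Rexpectation_sum (I : Type) (s : seq I) (f : I -> Omega -> R) :
  (forall i, Int (f i)) ->
  Ex (fun w => \sum_(i <- s) f i w) = \sum_(i <- s) Ex (f i).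
Proof.
move=> fi; elim: s => [|i s IH].
  rewrite big_nil; under eq_Rintegral do rewrite big_nil.
  exact: Rexpectation_cst.
rewrite big_cons -IH -RexpectationD//; last exact: integrable_real_sum.
by apply: eq_Rintegral => w _; rewrite big_cons.
Qed.

Lemma integrable_real_le (f g : Omega -> R) : measurable_fun setT f ->
  (forall w, `|f w| <= g w) -> Int g -> Int f.
Proof.
move=> mf fg gi; apply: le_integrable gi => //; first exact/measurable_EFinP.
by move=> w _ /=; rewrite lee_fin (le_trans (fg w))// ler_norm.
Qed.

Lemma le_Rexpectation (f g : Omega -> R) : Int f -> Int g ->
  (forall w, f w <= g w) -> Ex f <= Ex g.
Proof. by move=> fi gi fg; apply: le_Rintegral. Qed.

Definition centered_gaussian (X : Omega -> R) :=
  gaussian_rv P X /\ ('E_P[X] = 0)%E.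

Lemma centered_gaussian_measurable X : centered_gaussian X -> measurable_fun setT X.
Proof. by case=> -[]. Qed.

Lemma gaussian_integrable4 X : centered_gaussian X -> Int (fun w => X w ^+ 4).
Proof. by case=> h1 h2; have [] := gaussian_fourth_moment h1 h2. Qed.

Lemma gaussian_mean4 X : centered_gaussian X ->
  Ex (fun w => X w ^+ 4) = 3 * Ex (fun w => X w ^+ 2) ^+ 2.
Proof. by case=> h1 h2; have [] := gaussian_fourth_moment h1 h2. Qed.

Lemma gaussian_integrable2 X : centered_gaussian X -> Int (fun w => X w ^+ 2).
Proof.
move=> cX; apply: (@integrable_real_le _ (fun w => 1 + X w ^+ 4)).
- exact/measurable_funX/centered_gaussian_measurable.
- move=> w; rewrite ger0_norm ?sqr_ge0//.
  by have := sqr_ge0 (X w ^+ 2 - 2^-1); rewrite sqrrB -exprM; nra.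
- by apply: integrable_realD; [exact: integrable_real_cst|exact: gaussian_integrable4].
Qed.

Lemma gaussian_integrable1 X : centered_gaussian X -> Int X.
Proof.
move=> cX; apply: (@integrable_real_le _ (fun w => 1 + X w ^+ 2)).
- exact: centered_gaussian_measurable.
- by move=> w; rewrite ler_norml; apply/andP; split; nra.
- by apply: integrable_realD; [exact: integrable_real_cst|exact: gaussian_integrable2].
Qed.

Lemma gaussian_integrableM X Y : centered_gaussian X -> centered_gaussian Y ->
  Int (fun w => X w * Y w).
Proof.
move=> cX cY; apply: (@integrable_real_le _ (fun w => X w ^+ 2 + Y w ^+ 2)).
- by apply: measurable_funM; exact: centered_gaussian_measurable.
- by move=> w; rewrite ler_norml; apply/andP; split; nra.
- by apply: integrable_realD; exact: gaussian_integrable2.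
Qed.

Lemma gaussian_integrable22 X Y : centered_gaussian X -> centered_gaussian Y ->
  Int (fun w => X w ^+ 2 * Y w ^+ 2).
Proof.
move=> cX cY; apply: (@integrable_real_le _ (fun w => X w ^+ 4 + Y w ^+ 4)).
- by apply: measurable_funM; apply: measurable_funX; exact: centered_gaussian_measurable.
- move=> w; rewrite ger0_norm; last exact: mulr_ge0 (sqr_ge0 _) (sqr_ge0 _).
  rewrite (exprM _ 2 2) (exprM (Y w) 2 2).
  have := sqr_ge0 (X w ^+ 2 - Y w ^+ 2).
  have := sqr_ge0 (X w ^+ 2 + Y w ^+ 2).
  by nra.
- by apply: integrable_realD; exact: gaussian_integrable4.
Qed.

Lemma gaussian_mean_sqD X Y a b : centered_gaussian X -> centered_gaussian Y ->
  Ex (fun w => (a * X w + b * Y w) ^+ 2) =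
  a ^+ 2 * Ex (fun w => X w ^+ 2) + b ^+ 2 * Ex (fun w => Y w ^+ 2)
  + 2 * a * b * Ex (fun w => X w * Y w).
Proof.
move=> cX cY.
have iX := gaussian_integrable2 cX; have iY := gaussian_integrable2 cY.
have iXY := gaussian_integrableM cX cY.
rewrite -!RexpectationZ// -!RexpectationD//; try exact: integrable_realZ.
- by apply: eq_Rintegral => w _; ring.
- by apply: integrable_realD; exact: integrable_realZ.
Qed.

(** Isserlis' formula.  The fourth powers of [X + Y] and [X - Y] add up to
    [2 X^4 + 12 X^2 Y^2 + 2 Y^4], and each of
    them is three times the square of a variance. *)
Lemma gaussian_mean_sq_sq X Y : centered_gaussian X -> centered_gaussian Y ->
  centered_gaussian (fun w => X w + Y w) ->
  centered_gaussian (fun w => X w - Y w) ->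
  Ex (fun w => X w ^+ 2 * Y w ^+ 2) =
  Ex (fun w => X w ^+ 2) * Ex (fun w => Y w ^+ 2)
  + 2 * Ex (fun w => X w * Y w) ^+ 2.
Proof.
move=> cX cY cD cB.
have eD : Ex (fun w => (X w + Y w) ^+ 2) = Ex (fun w => X w ^+ 2) +
    Ex (fun w => Y w ^+ 2) + 2 * Ex (fun w => X w * Y w).
  have := gaussian_mean_sqD 1 1 cX cY; rewrite expr1n !mul1r !mulr1 => <-.
  by apply: eq_Rintegral => w _; ring.
have eB : Ex (fun w => (X w - Y w) ^+ 2) = Ex (fun w => X w ^+ 2) +
    Ex (fun w => Y w ^+ 2) - 2 * Ex (fun w => X w * Y w).
  have := gaussian_mean_sqD 1 (-1) cX cY; rewrite expr1n sqrrN expr1n !mul1r mulr1 mulrN1 mulNr => <-.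
  by apply: eq_Rintegral => w _; ring.
have e4 : Ex (fun w => (X w + Y w) ^+ 4) + Ex (fun w => (X w - Y w) ^+ 4) =
    2 * Ex (fun w => X w ^+ 4) + 2 * Ex (fun w => Y w ^+ 4)
    + 12 * Ex (fun w => X w ^+ 2 * Y w ^+ 2).
  have i4X := gaussian_integrable4 cX; have i4Y := gaussian_integrable4 cY.
  have iXY := gaussian_integrable22 cX cY.
  rewrite -!RexpectationZ// -!RexpectationD//; try exact: integrable_realZ.
  - by apply: eq_Rintegral => w _; ring.
  - by apply: integrable_realD; exact: integrable_realZ.
  - exact: gaussian_integrable4.
  - exact: gaussian_integrable4.
move: e4; rewrite !gaussian_mean4// eD eB.
by move=> h; lra.
Qed.

Section Block.
Variables (N : nat) (X : 'I_N -> Omega -> R) (v : R).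
Hypothesis cX : forall i, centered_gaussian (X i).
Hypothesis cXD : forall i j, centered_gaussian (fun w => X i w + X j w).
Hypothesis cXB : forall i j, centered_gaussian (fun w => X i w - X j w).
Hypothesis varX : forall i, Ex (fun w => X i w ^+ 2) = v.

Let Z w := \sum_(i < N) (X i w ^+ 2 - v).

Let covX i j :
  Int (fun w => (X i w ^+ 2 - v) * (X j w ^+ 2 - v)) /\
  Ex (fun w => (X i w ^+ 2 - v) * (X j w ^+ 2 - v)) =
    2 * Ex (fun w => X i w * X j w) ^+ 2.
Proof.
have iX := gaussian_integrable2 (cX i); have iY := gaussian_integrable2 (cX j).
have iXY := gaussian_integrable22 (cX i) (cX j).
have e : (fun w => (X i w ^+ 2 - v) * (X j w ^+ 2 - v)) =
   (fun w => X i w ^+ 2 * X j w ^+ 2 + (- v * X i w ^+ 2 + (- v * X j w ^+ 2 + v ^+ 2))).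
  by apply/funext => w; ring.
have i1 : Int (fun w => - v * X j w ^+ 2 + v ^+ 2).
  by apply: integrable_realD; [exact: integrable_realZ|exact: integrable_real_cst].
have i2 : Int (fun w => - v * X i w ^+ 2 + (- v * X j w ^+ 2 + v ^+ 2)).
  by apply: integrable_realD => //; exact: integrable_realZ.
rewrite e; split; first exact: integrable_realD.
rewrite (RexpectationD iXY i2) (RexpectationD (integrable_realZ (- v) iX) i1).
rewrite (RexpectationD (integrable_realZ (- v) iY) (integrable_real_cst _)).
rewrite Rexpectation_cst !RexpectationZ// !varX gaussian_mean_sq_sq// !varX.
by ring.
Qed.

Let Z2E : (fun w => Z w ^+ 2) = (fun w => \sum_(i < N) \sum_(j < N)
  (X i w ^+ 2 - v) * (X j w ^+ 2 - v)).
Proof.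
apply/funext => w; rewrite expr2 /Z mulr_suml.
by apply: eq_bigr => i _; rewrite mulr_sumr.
Qed.

Lemma square_block_integrable2 : Int (fun w => Z w ^+ 2).
Proof.
rewrite Z2E; apply: integrable_real_sum => i; apply: integrable_real_sum => j.
by have [] := covX i j.
Qed.

(** The products of variances in Isserlis' formula are removed by the centring. *)
Lemma square_block_mean2 :
  Ex (fun w => Z w ^+ 2) = 2 * \sum_(i < N) \sum_(j < N) Ex (fun w => X i w * X j w) ^+ 2.
Proof.
rewrite Z2E Rexpectation_sum; last first.
  by move=> i; apply: integrable_real_sum => j; have [] := covX i j.
rewrite mulr_sumr; apply: eq_bigr => i _.
rewrite Rexpectation_sum; last by move=> j; have [] := covX i j.
by rewrite mulr_sumr; apply: eq_bigr => j _; have [] := covX i j.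
Qed.

Lemma square_block_integrable : Int Z.
Proof.
apply: integrable_real_sum => i; apply: integrable_realD.
  exact: gaussian_integrable2.
exact: integrable_real_cst.
Qed.

(** The Cauchy-Schwarz inequality for variables of equal variance, read off
    from the variances of [X i + X j] and [X i - X j]. *)
Lemma gaussian_cov_le i j : `|Ex (fun w => X i w * X j w)| <= v.
Proof.
have ge0 a b : 0 <= Ex (fun w => (a * X i w + b * X j w) ^+ 2).
  by apply: Rintegral_ge0 => w _; exact: sqr_ge0.
rewrite ler_norml; apply/andP; split.
- have := ge0 1 1; rewrite gaussian_mean_sqD// !varX; lra.
- have := ge0 1 (-1); rewrite gaussian_mean_sqD// !varX; lra.
Qed.

End Block.

Lemma mean_abs_le_mean_sq (Z : Omega -> R) (l : R) : 0 < l ->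
  Int Z -> Int (fun w => Z w ^+ 2) ->
  Ex (fun w => `|Z w|) <= 2^-1 * (l + Ex (fun w => Z w ^+ 2) / l).
Proof.
move=> l0 iZ iZ2.
have iA : Int (fun w => `|Z w|) by exact: integrable_abse iZ.
have i1 : Int (fun w => l^-1 * Z w ^+ 2) by exact: integrable_realZ.
have i2 : Int (fun w => l + l^-1 * Z w ^+ 2).
  by apply: integrable_realD => //; exact: integrable_real_cst.
have -> : 2^-1 * (l + Ex (fun w => Z w ^+ 2) / l) =
    Ex (fun w => 2^-1 * (l + l^-1 * Z w ^+ 2)).
  rewrite RexpectationZ// RexpectationD//; last exact: integrable_real_cst.
  by rewrite Rexpectation_cst RexpectationZ// [_ / l]mulrC.
apply: le_Rexpectation => //; first exact: integrable_realZ.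
move=> w; rewrite -(ler_pM2l l0).
have -> : l * (2^-1 * (l + l^-1 * Z w ^+ 2)) = 2^-1 * (l ^+ 2 + `|Z w| ^+ 2).
  by rewrite real_normK ?num_real//; field; rewrite gt_eqF.
have := sqr_ge0 (l - `|Z w|); lra.
Qed.

End RealExpectation.

(** * Covariance of fractional Gaussian noise *)

Section FractionalCovariance.
Context {R : realType}.

Lemma powR_mid_convex (p a b : R) : 1 <= p -> 0 <= a -> 0 <= b ->
  2 * ((a + b) / 2) `^ p <= a `^ p + b `^ p.
Proof.
move=> p1 a0 b0.
have h : 0 <= (2^-1 : R) <= 1 by lra.
have -> : (a + b) / 2 = 2^-1 * a + (1 - 2^-1) * b by lra.
have : (2^-1 * a + (1 - 2^-1) * b) `^ p <= 2^-1 * a `^ p + (1 - 2^-1) * b `^ p.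
  by apply: (convex_powR p1 (Itv01 _ _)) => //=;
    rewrite ?inE/= ?in_itv/= ?andbT//; lra.
by lra.
Qed.

(** Midpoint convexity of [x `^ p^-1], applied to [a `^ p] and [b `^ p]. *)
Lemma powR_mid_concave (p a b : R) : 0 < p -> p <= 1 -> 0 <= a -> 0 <= b ->
  a `^ p + b `^ p <= 2 * ((a + b) / 2) `^ p.
Proof.
move=> p0 p1 a0 b0.
have q1 : 1 <= p^-1 by rewrite invf_ge1.
have q0 : 0 < p^-1 by lra.
have := powR_mid_convex q1 (powR_ge0 a p) (powR_ge0 b p).
rewrite -!powRrM mulfV ?gt_eqF// !powRr1// => h.
have h1 : ((a `^ p + b `^ p) / 2) `^ p^-1 <= (a + b) / 2 by lra.
have s0 : 0 <= (a `^ p + b `^ p) / 2 by rewrite divr_ge0// addr_ge0// powR_ge0.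
have := @ge0_ler_powR _ p (ltW p0) _ _ _ _ h1.
rewrite -powRrM mulVf ?gt_eqF// powRr1// !nnegrE => /(_ (powR_ge0 _ _)).
by move=> /(_ ltac:(lra)); lra.
Qed.

(** The covariance of the increments over [[i, i+1]] and [[j, j+1]] of a
    fractional Brownian motion with [p = 2 H]: it is a second difference of
    [- |i - j|^p / 2]. *)
Definition fgn_cov (p : R) (i j : nat) : R :=
  2^-1 * (`|i.+1%:R - j%:R| `^ p + `|i%:R - j.+1%:R| `^ p - 2 * `|i%:R - j%:R| `^ p).

Let g (p : R) (i j : nat) : R := - (2^-1 * `|i%:R - j%:R| `^ p).

Lemma fgn_covE p i j :
  fgn_cov p i j = (g p i.+1 j.+1 - g p i.+1 j) - (g p i j.+1 - g p i j).
Proof.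
rewrite /fgn_cov /g (_ : i.+1%:R - j.+1%:R = i%:R - j%:R); last by rewrite -!natr1; ring.
by field.
Qed.

(** The double sum telescopes; it is the variance at time [N]. *)
Lemma sum_fgn_cov p (N : nat) : p != 0 ->
  \sum_(i < N) \sum_(j < N) fgn_cov p i j = N%:R `^ p.
Proof.
move=> p0.
transitivity (\sum_(i < N) ((g p i.+1 N - g p i.+1 0) - (g p i N - g p i 0))).
  apply: eq_bigr => i _; under eq_bigr do rewrite fgn_covE.
  rewrite sumrB -(big_mkord xpredT (fun j => g p i.+1 j.+1 - g p i.+1 j)).
  rewrite -(big_mkord xpredT (fun j => g p i j.+1 - g p i j)).
  by rewrite !telescope_sumr.
rewrite -(big_mkord xpredT (fun i => (g p i.+1 N - g p i.+1 0) - (g p i N - g p i 0))).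
rewrite (eq_bigr (fun i => (g p i.+1 N - g p i N) - (g p i.+1 0 - g p i 0))).
  rewrite sumrB !telescope_sumr// /g !subrr normr0 sub0r subr0 normrN normr_nat powR0//.
  by field.
by move=> i _; ring.
Qed.

Lemma fgn_cov_diag p i : p != 0 -> fgn_cov p i i = 1.
Proof.
move=> p0; rewrite /fgn_cov subrr normr0 powR0// -[i.+1%:R]natr1.
rewrite (_ : i%:R + 1 - i%:R = 1 :> R); last by ring.
rewrite (_ : i%:R - (i%:R + 1) = -1 :> R); last by ring.
by rewrite normrN normr1 powR1; field.
Qed.

(** Off the diagonal the covariance compares [x `^ p] at the midpoint of an
    interval with its values at the ends, so its sign is that of [p - 1]. *)
Lemma fgn_cov_mid p i j : (i != j)%N ->
  exists a b : R, [/\ 0 <= a, 0 <= b &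
   fgn_cov p i j = 2^-1 * (a `^ p + b `^ p - 2 * ((a + b) / 2) `^ p)].
Proof.
move=> ij; exists `|i.+1%:R - j%:R|, `|i%:R - j.+1%:R|; split => //.
rewrite /fgn_cov; congr (_ * (_ - 2 * _ `^ p)).
have [lij|lji] := leqP j i.
  have lt_ji : (j < i)%N by rewrite ltn_neqAle eq_sym ij.
  have h : (j%:R + 1 <= i%:R :> R) by rewrite natr1 ler_nat.
  by rewrite -[i.+1%:R]natr1 -[j.+1%:R]natr1 !ger0_norm; lra.
have h : (i%:R + 1 <= j%:R :> R) by rewrite natr1 ler_nat.
by rewrite -[i.+1%:R]natr1 -[j.+1%:R]natr1 !ler0_norm; lra.
Qed.

(** Since [|r_ij| <= 1], each square is at most [|r_ij|], whose sum is known
    because the signs are constant: for [p >= 1] all [r_ij] are nonnegative and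
    the sum is [N^p]; for [p <= 1] it is [2 N - N^p], as [r_ii = 1]. *)
Lemma sum_fgn_cov_sq p (N : nat) : 0 < p ->
  (forall i j : 'I_N, `|fgn_cov p i j| <= 1) ->
  \sum_(i < N) \sum_(j < N) fgn_cov p i j ^+ 2 <= 2 * N%:R `^ Num.max 1 p.
Proof.
move=> p0 h1; have pn0 : p != 0 by rewrite gt_eqF.
have sq_le (i j : 'I_N) : fgn_cov p i j ^+ 2 <= `|fgn_cov p i j|.
  by rewrite -real_normK ?num_real// expr2 ler_piMl.
have [p1|p1] := leP 1 p.
  apply: (@le_trans _ _ (N%:R `^ p)); last by rewrite ler_peMl ?powR_ge0// ler1n.
  rewrite -(sum_fgn_cov _ pn0); apply: ler_sum => i _; apply: ler_sum => j _.
  rewrite (le_trans (sq_le i j))// ger0_norm//.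
  have [<-|ij] := eqVneq (i : nat) j; first by rewrite fgn_cov_diag.
  have [a [b [a0 b0 ->]]] := fgn_cov_mid p ij.
  by rewrite mulr_ge0// subr_ge0 powR_mid_convex.
rewrite powRr1//.
apply: (@le_trans _ _ (\sum_(i < N) \sum_(j < N) (2 * (i == j)%:R - fgn_cov p i j))).
  apply: ler_sum => i _; apply: ler_sum => j _.
  rewrite (le_trans (sq_le i j))//.
  have [<-|ij] := eqVneq i j; first by rewrite fgn_cov_diag// normr1 ?eqxx mulr1; lra.
  have [a [b [a0 b0 e]]] := fgn_cov_mid p ij.
  rewrite ler0_norm ?mulr0 ?sub0r//.
  by rewrite e pmulr_rle0// subr_le0 powR_mid_concave// ltW.
under eq_bigr do rewrite sumrB.
rewrite sumrB sum_fgn_cov// lerBlDr.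
apply: (@le_trans _ _ (2 * N%:R)); last by rewrite lerDl powR_ge0.
rewrite (eq_bigr (fun=> 2)); last first.
  move=> i _; rewrite (bigD1 i)//= eqxx mulr1 big1 ?addr0// => j.
  by rewrite eq_sym => /negbTE ->; rewrite mulr0.
by rewrite sumr_const card_ord mulr_natr.
Qed.

End FractionalCovariance.

(** * Almost sure bounds from summable means *)

Section AlmostSureRate.
Context {R : realType} {d : measure_display} {Omega : measurableType d}.
Variable P : probability Omega R.
Local Notation Int f := (P.-integrable setT (EFin \o f)).
Local Notation Ex f := (Rintegral P setT f).

Lemma expectationE X : Int X -> ('E_P[X] = (Ex X)%:E)%E.
Proof.
by move=> iX; rewrite unlock /Rintegral fineK//; exact: integrable_fin_num.
Qed.

(** The sum of the series [Y n] is integrable, hence almost surely finite, and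
    it bounds each of its terms. *)
Lemma ae_bounded_of_geometric_mean (Y : nat -> Omega -> R) (A q : R) :
  0 < q < 1 -> 0 <= A -> (forall n, Int (Y n)) -> (forall n w, 0 <= Y n w) ->
  (forall n, Ex (Y n) <= A * q ^+ n) ->
  {ae P, forall w, exists C : R, forall n, Y n w <= C}.
Proof.
move=> /andP[q0 q1] A0 iY Y0 hY.
have mY n : measurable_fun setT (EFin \o Y n) by exact: measurable_int (iY n).
pose F w := (\sum_(n <oo) (Y n w)%:E)%E.
have intF : (\int[P]_w F w <= (A * (1 - q)^-1)%:E)%E.
  rewrite /F integral_nneseries//; last by move=> n x _; rewrite lee_fin.
  apply: lime_le.
    by apply: is_cvg_nneseries => n _ _; apply: integral_ge0 => w _; rewrite lee_fin.
  apply: nearW => k.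
  apply: (@le_trans _ _ (\sum_(0 <= i < k) (A * q ^+ i)%:E)%E).
    apply: lee_sum => i _; apply: le_trans (_ : (Ex (Y i))%:E <= _)%E; last first.
      by rewrite lee_fin.
    by rewrite /Rintegral fineK//; exact: (integrable_fin_num measurableT (iY i)).
  rewrite sumEFin lee_fin.
  have := @geometric_le_lim R k A q A0 q0.
  by rewrite ger0_norm ?(ltW q0)// => /(_ q1).
have mF : measurable_fun setT F.
  by apply: ge0_emeasurable_sum => [n w _ _|n _]; [rewrite lee_fin|exact: mY].
have F0 w : (0 <= F w)%E by apply: nneseries_ge0 => n _ _; rewrite lee_fin.
have iF : P.-integrable setT F.
  apply/integrableP; split => //.
  under eq_integral do rewrite gee0_abs//.
  by rewrite (le_lt_trans intF)// ltry.
have := integrable_ae measurableT iF.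
apply: filterS => w /(_ I) Ffin.
exists (fine (F w)) => n; rewrite -lee_fin fineK//.
apply: le_trans (@nneseries_lim_ge R (fun n => (Y n w)%:E) xpredT 0 n.+1 _).
  rewrite big_nat_recr//= leeDr// sume_ge0// => i _.
  by rewrite lee_fin.
by move=> k _ _; rewrite lee_fin.
Qed.

End AlmostSureRate.

(** * Increments of fractional Brownian motion on a dyadic grid *)

Section LinearCombination.
Context {R : realType} {d : measure_display} {Omega : measurableType d}.
Variable P : probability Omega R.
Local Notation Int f := (P.-integrable setT (EFin \o f)).
Local Notation Ex f := (Rintegral P setT f).
Variables (K : nat) (T H : R) (B : R -> Omega -> 'cV[R]_K).
Hypothesis fB : fractional_brownian_motion P T H B.
Variable c : 'I_K -> R.

Definition lincomb t w : R := \sum_(k < K) c k * B t w k 0.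

Lemma fbm_coord_gaussian t k : 0 <= t <= T -> centered_gaussian P (fun w => B t w k 0).
Proof.
move=> tT; case: fB => -[hg h0] _ _; split; last exact: h0.
have := hg 1%N (fun=> t) (fun _ l => (l == k)%:R) (fun=> tT).
rewrite (_ : (fun w => _) = (fun w => B t w k 0))//.
apply/funext => w; rewrite big_ord1 (bigD1 k)//= eqxx mul1r big1 ?addr0//.
by move=> l /negbTE ->; rewrite mul0r.
Qed.

(** Lists of times and coefficients let one statement cover the combinations of
    two increments, which involve four times. *)
Lemma lincomb_gaussian (ts as_ : seq R) : all (fun t => 0 <= t <= T) ts ->
  size as_ = size ts ->
  centered_gaussian P (fun w => \sum_(i < size ts) as_`_i * lincomb ts`_i w).
Proof.
move=> hts sz.
have tin (i : 'I_(size ts)) : 0 <= ts`_i <= T.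
  by move/all_nthP : hts => /(_ 0 i (ltn_ord i)).
(* A combination of combinations of coordinates is one combination. *)
have eq_comb : (fun w => \sum_(i < size ts) as_`_i * lincomb ts`_i w) =
   (fun w => \sum_(i < size ts) \sum_(k < K) (as_`_i * c k) * B ts`_i w k 0).
  apply/funext => w; apply: eq_bigr => i _; rewrite /lincomb mulr_sumr.
  by apply: eq_bigr => k _; rewrite mulrA.
rewrite eq_comb; case: fB => -[hg h0] _ _; split.
  exact: (hg _ (fun i : 'I_(size ts) => ts`_i)).
have iB (i : 'I_(size ts)) k : Int (fun w => (as_`_i * c k) * B ts`_i w k 0).
  by apply: integrable_realZ; apply: gaussian_integrable1; exact: fbm_coord_gaussian.
rewrite expectationE; last first.
  by apply: integrable_real_sum => i; exact: integrable_real_sum.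
rewrite Rexpectation_sum; last by move=> i; exact: integrable_real_sum.
rewrite big1// => i _; rewrite Rexpectation_sum// big1// => k _.
have gB := fbm_coord_gaussian k (tin i).
rewrite RexpectationZ; last exact: gaussian_integrable1.
suff -> : Ex (fun w => B ts`_i w k 0) = 0 by rewrite mulr0.
apply: EFin_inj; rewrite -expectationE; last exact: gaussian_integrable1.
by case: gB.
Qed.

Definition fbm_cov (s t : R) : R :=
  2^-1 * (t `^ (2 * H) + s `^ (2 * H) - `|t - s| `^ (2 * H)).

Lemma lincomb_cov s t : 0 <= s <= T -> 0 <= t <= T ->
  Int (fun w => lincomb t w * lincomb s w) /\
  Ex (fun w => lincomb t w * lincomb s w) = (\sum_(k < K) c k ^+ 2) * fbm_cov s t.
Proof.
move=> sT tT.
have e : (fun w => lincomb t w * lincomb s w) =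
  (fun w => \sum_(k < K) \sum_(l < K) (c k * c l) * (B t w k 0 * B s w l 0)).
  apply/funext => w; rewrite /lincomb mulr_suml; apply: eq_bigr => k _.
  by rewrite mulr_sumr; apply: eq_bigr => l _; ring.
have iBB k l : Int (fun w => B t w k 0 * B s w l 0).
  by apply: gaussian_integrableM; exact: fbm_coord_gaussian.
have i1 k l : Int (fun w => (c k * c l) * (B t w k 0 * B s w l 0)).
  exact: integrable_realZ.
rewrite e; split.
  by apply: integrable_real_sum => k; exact: integrable_real_sum.
rewrite Rexpectation_sum; last by move=> k; exact: integrable_real_sum.
rewrite mulr_suml; apply: eq_bigr => k _.
rewrite Rexpectation_sum// (bigD1 k)//= big1 ?addr0.
  rewrite RexpectationZ// -expr2; congr (_ * _).
  case: fB => _ /(_ s t k k sT tT) + _; rewrite expectationE// => -[->].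
  by rewrite eqxx mulr1n.
move=> l lk; rewrite RexpectationZ//.
case: fB => _ /(_ s t k l sT tT) + _; rewrite expectationE// => -[->].
by rewrite eq_sym (negbTE lk) mulr0n mulr0.
Qed.

End LinearCombination.

Section DyadicIncrements.
Context {R : realType} {d : measure_display} {Omega : measurableType d}.
Variable P : probability Omega R.
Local Notation Int f := (P.-integrable setT (EFin \o f)).
Local Notation Ex f := (Rintegral P setT f).
Variables (K : nat) (T H : R) (B : R -> Omega -> 'cV[R]_K).
Hypothesis T0 : 0 < T.
Hypothesis H0 : 0 < H.
Hypothesis fB : fractional_brownian_motion P T H B.
Variable c : 'I_K -> R.
Let v := \sum_(k < K) c k ^+ 2.
Hypothesis v0 : 0 < v.

Definition mesh (n : nat) : R := T / 2 ^+ n.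
Definition dyadic_incr (n i : nat) w : R :=
  lincomb B c (dyadic T n i.+1) w - lincomb B c (dyadic T n i) w.
Definition incr_var (n : nat) : R := v * mesh n `^ (2 * H).

Lemma mesh_gt0 n : 0 < mesh n.
Proof. by rewrite divr_gt0// exprn_gt0. Qed.

Lemma incr_var_gt0 n : 0 < incr_var n.
Proof. by rewrite mulr_gt0// powR_gt0// mesh_gt0. Qed.

Lemma dyadicE n i : dyadic T n i = i%:R * mesh n.
Proof. by rewrite /dyadic /mesh mulrA. Qed.

Lemma dyadic_in_itv n i : (i <= 2 ^ n)%N -> 0 <= dyadic T n i <= T.
Proof.
move=> hi; rewrite dyadicE mulr_ge0 ?(ltW (mesh_gt0 n))//=.
rewrite /mesh mulrA ler_pdivrMr ?exprn_gt0// mulrC ler_pM2l//.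
by rewrite -natrX ler_nat.
Qed.

Lemma dyadic_incr_gaussian n i j (a b : R) : (i < 2 ^ n)%N -> (j < 2 ^ n)%N ->
  centered_gaussian P (fun w => a * dyadic_incr n i w + b * dyadic_incr n j w).
Proof.
move=> hi hj.
have := @lincomb_gaussian _ _ _ P K T H B fB c
  [:: dyadic T n i.+1; dyadic T n i; dyadic T n j.+1; dyadic T n j]
  [:: a; - a; b; - b] _ (erefl _).
rewrite /= !dyadic_in_itv// ?(ltnW hi)// ?(ltnW hj)// => /(_ isT).
rewrite (_ : (fun w => _) = (fun w => a * dyadic_incr n i w + b * dyadic_incr n j w))//.
apply/funext => w; rewrite !big_ord_recl big_ord0 /= /dyadic_incr.
ring.
Qed.

Lemma dyadic_incr_centered n i : (i < 2 ^ n)%N -> centered_gaussian P (dyadic_incr n i).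
Proof.
move=> hi; have := dyadic_incr_gaussian 1 0 hi hi.
rewrite (_ : (fun w => _) = dyadic_incr n i)//.
by apply/funext => w; rewrite mul1r mul0r addr0.
Qed.

Lemma dyadic_incr_cov n i j : (i < 2 ^ n)%N -> (j < 2 ^ n)%N ->
  Ex (fun w => dyadic_incr n i w * dyadic_incr n j w) = incr_var n * fgn_cov (2 * H) i j.
Proof.
move=> hi hj.
have hi' := ltnW hi; have hj' := ltnW hj.
have [i1 e1] := lincomb_cov fB c (dyadic_in_itv hj) (dyadic_in_itv hi).
have [i2 e2] := lincomb_cov fB c (dyadic_in_itv hj') (dyadic_in_itv hi).
have [i3 e3] := lincomb_cov fB c (dyadic_in_itv hj) (dyadic_in_itv hi').
have [i4 e4] := lincomb_cov fB c (dyadic_in_itv hj') (dyadic_in_itv hi').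
set W := lincomb B c in i1 e1 i2 e2 i3 e3 i4 e4 *.
have e : (fun w => dyadic_incr n i w * dyadic_incr n j w) = (fun w =>
   W (dyadic T n i.+1) w * W (dyadic T n j.+1) w +
   (-1 * (W (dyadic T n i.+1) w * W (dyadic T n j) w) +
   (-1 * (W (dyadic T n i) w * W (dyadic T n j.+1) w) +
    W (dyadic T n i) w * W (dyadic T n j) w))).
  by apply/funext => w; rewrite /dyadic_incr -/W; ring.
have j1 : Int (fun w => -1 * (W (dyadic T n i) w * W (dyadic T n j.+1) w)).
  exact: integrable_realZ.
have j2 : Int (fun w => -1 * (W (dyadic T n i.+1) w * W (dyadic T n j) w)).
  exact: integrable_realZ.
have j3 := integrable_realD j1 i4.
have j4 := integrable_realD j2 j3.
rewrite e (RexpectationD i1 j4) (RexpectationD j2 j3) (RexpectationD j1 i4).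
rewrite (RexpectationZ _ i2) (RexpectationZ _ i3) e1 e2 e3 e4 -/v /fbm_cov /incr_var.
have dE a b : `|dyadic T n a - dyadic T n b| `^ (2 * H) =
    mesh n `^ (2 * H) * `|a%:R - b%:R| `^ (2 * H).
  rewrite !dyadicE -mulrBl normrM [`|mesh n|]ger0_norm ?(ltW (mesh_gt0 n))//.
  by rewrite powRM// 1?mulrC// ltW// mesh_gt0.
rewrite !dE /fgn_cov (_ : i.+1%:R - j.+1%:R = i%:R - j%:R).
  by field.
by rewrite -[i.+1%:R]natr1 -[j.+1%:R]natr1; ring.
Qed.

Lemma dyadic_incr_var n i : (i < 2 ^ n)%N -> Ex (fun w => dyadic_incr n i w ^+ 2) = incr_var n.
Proof.
by move=> hi; rewrite dyadic_incr_cov// fgn_cov_diag ?mulr1// gt_eqF// mulr_gt0.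
Qed.

(** The exponent [h] of the growth of block sums of centred squares: they are of
    order [N^(1/2)] while the noise has short memory, and at most of order [N^H]
    when [H > 1/2]. *)
Definition hmax : R := Num.max 2^-1 H.

Definition square_block (n N b : nat) w : R :=
  \sum_(j < N) (dyadic_incr n (b * N + j) w ^+ 2 - incr_var n).

Lemma fgn_cov_shift p b i j :
  fgn_cov p (b + i) (b + j) = fgn_cov p i j :> R.
Proof.
have e (x y : R) : b%:R + x - (b%:R + y) = x - y by ring.
by rewrite /fgn_cov -!addnS !natrD !e.
Qed.

(** The mean of [|Z|] is controlled by the second moment of the block, which
    Isserlis' formula turns into a sum of squared covariances. *)
Lemma square_block_L1 n N b : (0 < N)%N -> (b.+1 * N <= 2 ^ n)%N ->
  Int (fun w => `|square_block n N b w|) /\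
  Ex (fun w => `|square_block n N b w|) <= 2 * incr_var n * N%:R `^ hmax.
Proof.
move=> N0 hb.
have hj (j : 'I_N) : (b * N + j < 2 ^ n)%N.
  by rewrite (leq_trans _ hb)// mulSn addnC ltn_add2r.
pose X (j : 'I_N) := dyadic_incr n (b * N + j).
have cX j : centered_gaussian P (X j) by exact: dyadic_incr_centered.
have cXD i j : centered_gaussian P (fun w => X i w + X j w).
  have := dyadic_incr_gaussian 1 1 (hj i) (hj j).
  by under eq_fun do rewrite !mul1r.
have cXB i j : centered_gaussian P (fun w => X i w - X j w).
  have := dyadic_incr_gaussian 1 (-1) (hj i) (hj j).
  by under eq_fun do rewrite mul1r mulN1r.
have varX i : Ex (fun w => X i w ^+ 2) = incr_var n by exact: dyadic_incr_var.
have iZ : Int (square_block n N b) by exact: (square_block_integrable _ cX).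
have iZ2 : Int (fun w => square_block n N b w ^+ 2).
  exact: (square_block_integrable2 cX cXD cXB varX).
split; first exact: integrable_abse iZ.
have v1 := incr_var_gt0 n.
have covX i j : Ex (fun w => X i w * X j w) = incr_var n * fgn_cov (2 * H) i j.
  by rewrite dyadic_incr_cov// fgn_cov_shift.
have cov1 (i j : 'I_N) : `|fgn_cov (2 * H) i j| <= 1 :> R.
  have := gaussian_cov_le cX varX i j; rewrite covX normrM (gtr0_norm v1).
  by rewrite -{2}[incr_var n]mulr1 ler_pM2l.
(* This bound l satisfies E Z^2 <= l^2, and |Z| <= (l + Z^2 / l) / 2. *)
have l0 : 0 < 2 * incr_var n * N%:R `^ hmax.
  apply: mulr_gt0; first exact: mulr_gt0. by rewrite powR_gt0// ltr0n.
have Z2 : Ex (fun w => square_block n N b w ^+ 2) <= (2 * incr_var n * N%:R `^ hmax) ^+ 2.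
  rewrite (square_block_mean2 cX cXD cXB varX).
  under eq_bigr do under eq_bigr do rewrite covX exprMn.
  under eq_bigr do rewrite -mulr_sumr.
  rewrite -mulr_sumr.
  have -> : (2 * incr_var n * N%:R `^ hmax) ^+ 2 =
      2 * (incr_var n ^+ 2 * (2 * N%:R `^ Num.max 1 (2 * H))).
    have -> : Num.max 1 (2 * H) = hmax * 2.
      by rewrite /hmax maxr_pMl// mulVf// [H * 2]mulrC.
    rewrite powRrM (powR_mulrn 2) ?powR_ge0//; ring.
  rewrite ler_pM2l// ler_pM2l ?exprn_gt0//.
  by apply: sum_fgn_cov_sq => //; rewrite mulr_gt0.
apply: (le_trans (mean_abs_le_mean_sq l0 iZ iZ2)).
rewrite -ler_pdivlMl// invrK.
have : Ex (fun w => square_block n N b w ^+ 2) / (2 * incr_var n * N%:R `^ hmax) <= 2 * incr_var n * N%:R `^ hmax.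
  by rewrite ler_pdivrMr// -expr2.
lra.
Qed.

End DyadicIncrements.

(** * Centred squares summed over coarse blocks *)

Section BlockRate.
Context {R : realType} {d : measure_display} {Omega : measurableType d}.
Variable P : probability Omega R.
Local Notation Int f := (P.-integrable setT (EFin \o f)).
Local Notation Ex f := (Rintegral P setT f).
Variables (K : nat) (T H : R) (B : R -> Omega -> 'cV[R]_K).
Hypothesis T0 : 0 < T.
Hypothesis H01 : 0 < H < 1.
Hypothesis fB : fractional_brownian_motion P T H B.
Variable c : 'I_K -> R.
Let v := \sum_(k < K) c k ^+ 2.
Hypothesis v0 : 0 < v.
Let h := hmax H.

(** The level of the blocks on which the weights are frozen, [m = floor(n (1 - h))].
    Freezing costs [2^-(m a)] with [a] close to [H], and the block sums are of
    relative size [2^-((n - m) (1 - h))]; this [m] makes both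
    [O(2^-(n (1 - h) p))] for every [p < H]. *)
Definition coarse (n : nat) : nat := Num.truncn (n%:R * (1 - hmax H)).

Let h01 : 0 < h < 1.
Proof.
case/andP: H01 => H0 H1; rewrite /h /hmax lt_max H0 orbT/= gt_max H1 andbT.
by rewrite invf_lt1// ltr1n.
Qed.

Lemma coarse_le n : (coarse n)%:R <= n%:R * (1 - h).
Proof.
by case/andP: h01 => h0 h1; rewrite /coarse truncn_le// mulr_ge0// subr_ge0 ltW.
Qed.

Lemma coarse_gt n : n%:R * (1 - h) - 1 < (coarse n)%:R.
Proof.
rewrite ltrBlDr natr1; case/andP: h01 => h0 h1.
by rewrite truncnS_gt.
Qed.

Lemma coarse_leq n : (coarse n <= n)%N.
Proof.
rewrite -(ler_nat R) (le_trans (coarse_le n))// ler_piMr//.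
by case/andP: h01 => h0 h1; lra.
Qed.

Definition blocksum (n : nat) (w : Omega) : R :=
  \sum_(b < 2 ^ coarse n) `|square_block T H B c n (2 ^ (n - coarse n)) b w|.

Lemma pow2_powR (n : nat) : 2 ^+ n = 2 `^ n%:R :> R.
Proof. by rewrite powR_mulrn. Qed.

Lemma blocksum_L1 n : Int (blocksum n) /\
  Ex (blocksum n) <= 2 * v * (2 `^ (- (n%:R * (h * (1 - h)))) * (2 ^+ n * mesh T n `^ (2 * H))).
Proof.
have H0 : 0 < H by case/andP: H01.
have hb (b : 'I_(2 ^ coarse n)) : (b.+1 * 2 ^ (n - coarse n) <= 2 ^ n)%N.
  have e : (2 ^ n = 2 ^ coarse n * 2 ^ (n - coarse n))%N.
    by rewrite -expnD subnKC ?coarse_leq.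
  by rewrite e leq_mul2r (ltn_ord b) orbT.
have N0 : (0 < 2 ^ (n - coarse n))%N by rewrite expn_gt0.
have hL b := square_block_L1 T0 H0 fB v0 N0 (hb b).
split; first by apply: integrable_real_sum => b; have [] := hL b.
rewrite Rexpectation_sum; last by move=> b; have [] := hL b.
apply: (@le_trans _ _ (\sum_(b < 2 ^ coarse n) 2 * incr_var T H c n * (2 ^ (n - coarse n))%:R `^ h)).
  by apply: ler_sum => b _; have [] := hL b.
rewrite sumr_const card_ord -[leLHS]mulr_natl !natrX /incr_var -/v.
rewrite !pow2_powR -powRrM.
set M := mesh _ _ `^ _; have M0 : 0 <= M by rewrite powR_ge0.
rewrite [leLHS](_ : _ = 2 * v * (2 `^ (coarse n)%:R * 2 `^ ((n - coarse n)%:R * h) * M)); last by ring.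
rewrite ler_pM2l; last by rewrite mulr_gt0.
rewrite mulrA ler_wpM2r// -!powRD//; try by apply/implyP.
rewrite ler_powR ?ler1n// natrB ?coarse_leq//.
have := coarse_le n; case/andP: h01 => h0 h1; nra.
Qed.

(** The means of [2^(n beta)] times the relative block sums decrease
    geometrically. *)
Lemma blocksum_rate (beta : R) : beta < h * (1 - h) ->
  {ae P, forall w, exists C : R, forall n,
     blocksum n w <= C * 2 `^ (- (n%:R * beta)) * (2 ^+ n * mesh T n `^ (2 * H))}.
Proof.
move=> hbeta; pose s n := 2 ^+ n * mesh T n `^ (2 * H).
have s0 n : 0 < s n by rewrite mulr_gt0 ?exprn_gt0// powR_gt0// mesh_gt0.
pose q : R := 2 `^ (beta - h * (1 - h)).
pose Y n w := (2 `^ (n%:R * beta) / s n) * blocksum n w.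
have q01 : 0 < q < 1.
  rewrite powR_gt0//= /q -opprB powRN invf_lt1 ?powR_gt0//.
  by rewrite /powR pnatr_eq0/= expR_gt1 mulr_gt0 ?subr_gt0// ln_gt0// ltr1n.
have iY n : Int (Y n) by apply: integrable_realZ; have [] := blocksum_L1 n.
have Y0 n w : 0 <= Y n w.
  by rewrite mulr_ge0 ?divr_ge0 ?powR_ge0// ?(ltW (s0 n))// sumr_ge0.
have hY n : Ex (Y n) <= 2 * v * q ^+ n.
  have [i1 i2] := blocksum_L1 n.
  rewrite RexpectationZ//.
  have c0 : 0 <= 2 `^ (n%:R * beta) / s n.
    by rewrite divr_ge0 ?powR_ge0// ltW.
  apply: le_trans (ler_wpM2l c0 i2) _; rewrite -/(s n).
  rewrite [leLHS](_ : _ = 2 * v * (2 `^ (n%:R * beta) * 2 `^ (- (n%:R * (h * (1 - h)))))).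
    rewrite -powRD; last by apply/implyP.
    by rewrite -mulrBr [n%:R * _]mulrC powRrM powR_mulrn ?powR_ge0.
  by field; rewrite gt_eqF.
have v2 : 0 <= 2 * v by rewrite mulr_ge0// ltW.
have := ae_bounded_of_geometric_mean q01 v2 iY Y0 hY.
apply: filterS => w [C hC]; exists C => n.
have := hC n; rewrite /Y mulrAC ler_pdivrMr// => hn.
rewrite powRN mulrAC -/(s n) ler_pdivlMr ?powR_gt0// mulrC.
exact: hn.
Qed.

End BlockRate.

(** * Sequences of geometric order *)

Section DyadicRate.
Context {R : realType}.
Implicit Types (b : R) (f g : nat -> R).

(** [f n = O(2^-(n b))]; [b] may be negative.  Rates are added under products, so
    that powers of the mesh combine as in asymptotic computations. *)
Definition Orate b f := exists C : R, forall n, `|f n| <= C * 2 `^ (- (n%:R * b)).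

Let p0 (x : R) : 0 <= 2 `^ x. Proof. exact: powR_ge0. Qed.

Lemma Orate_dom b f g : (forall n, `|f n| <= g n) -> Orate b g -> Orate b f.
Proof.
move=> fg [C hC]; exists C => n; rewrite (le_trans (fg n))//.
by rewrite (le_trans _ (hC n))// ler_norm.
Qed.

Lemma Orate_ge0 b f : Orate b f ->
  exists2 C : R, 0 <= C & forall n, `|f n| <= C * 2 `^ (- (n%:R * b)).
Proof.
move=> [C hC]; exists C => //.
by have := le_trans (normr_ge0 _) (hC 0); rewrite pmulr_lge0// powR_gt0.
Qed.

Lemma Orate_weaken b b' f : b' <= b -> Orate b f -> Orate b' f.
Proof.
move=> bb /Orate_ge0[C C0 hC]; exists C => n; rewrite (le_trans (hC n))//.
by rewrite ler_wpM2l// ler_powR ?ler1n// lerN2 ler_wpM2l.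
Qed.

Lemma OrateD b f g : Orate b f -> Orate b g -> Orate b (fun n => f n + g n).
Proof.
move=> [C hC] [D hD]; exists (C + D) => n.
by rewrite mulrDl (le_trans (ler_normD _ _))// lerD.
Qed.

Lemma OrateM b b' f g : Orate b f -> Orate b' g -> Orate (b + b') (fun n => f n * g n).
Proof.
move=> [C hC] [D hD]; exists (C * D) => n.
rewrite mulrDr opprD powRD; last by apply/implyP.
by rewrite mulrACA normrM ler_pM.
Qed.

Lemma Orate_cst (a : R) : Orate 0 (fun=> a).
Proof. by exists `|a| => n; rewrite mulr0 oppr0 powRr0 mulr1. Qed.

Lemma OrateZ (a : R) b f : Orate b f -> Orate b (fun n => a * f n).
Proof. by move=> hf; have := OrateM (Orate_cst a) hf; rewrite add0r. Qed.

Lemma Orate0 b : Orate b (fun=> 0).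
Proof. by exists 0 => n; rewrite normr0 mul0r. Qed.

Lemma Orate_sum (I : Type) (s : seq I) b (f : I -> nat -> R) :
  (forall i, Orate b (f i)) -> Orate b (fun n => \sum_(i <- s) f i n).
Proof.
move=> hf; elim: s => [|i s IH].
  by under eq_fun do rewrite big_nil; exact: Orate0.
by under eq_fun do rewrite big_cons; exact: OrateD.
Qed.

Lemma mesh_powR (T x : R) n : 0 < T ->
  mesh T n `^ x = T `^ x * 2 `^ (- (n%:R * x)).
Proof.
move=> T0; rewrite /mesh powRM ?invr_ge0 ?exprn_ge0 ?(ltW T0)//.
by rewrite -(powR_mulrn n)// -powRN -powRrM mulNr.
Qed.

Lemma Orate_mesh (T x : R) : 0 < T -> Orate x (fun n => mesh T n `^ x).
Proof.
move=> T0; exists (T `^ x) => n.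
by rewrite ger0_norm ?powR_ge0// mesh_powR.
Qed.

Lemma Orate_eventually_le b f e : 0 < b -> 0 < e -> Orate b f ->
  exists N, forall n, (N <= n)%N -> `|f n| <= e.
Proof.
move=> b0 e0 [C hC].
have q01 : 0 < (2 `^ (- b) : R) < 1.
  rewrite powR_gt0//= powRN invf_lt1 ?powR_gt0//.
  by rewrite /powR pnatr_eq0/= expR_gt1 mulr_gt0// ln_gt0// ltr1n.
have := @cvg_geometric R C (2 `^ (- b)); rewrite ger0_norm//.
move: q01 => /andP[q0 q1] /(_ q1) /cvgrPdist_le /(_ e e0) [N _ hN].
exists N => n /hN /=; rewrite sub0r normrN => h.
rewrite (le_trans (hC n))// (le_trans _ h)//.
have -> : 2 `^ (- (n%:R * b)) = (2 `^ (- b)) ^+ n :> R.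
  by rewrite -mulrN [n%:R * _]mulrC powRrM powR_mulrn.
exact: ler_norm.
Qed.

(** [W] stands for a main term that stays away from [0] and moves slowly.  Then
    so does [A], and [ln] is Lipschitz away from [0]. *)
Lemma ln_ratio_rate b (A W : nat -> R) c : 0 < b -> 0 < c ->
  (exists N, forall n, (N <= n)%N -> c <= W n) ->
  Orate b (fun n => A n - W n) -> Orate b (fun n => W n.+1 - W n) ->
  exists N (C : R), forall n, (N <= n)%N ->
    [/\ 0 < A n, 0 < A n.+1 & `|ln (A n.+1 / A n)| <= C * 2 `^ (- (n%:R * b))].
Proof.
move=> b0 c0 [N1 hN1] hA hW.
have [N2 hN2] : exists N, forall n, (N <= n)%N -> `|A n - W n| <= c / 2.
  by apply: Orate_eventually_le hA => //; rewrite divr_gt0.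
have Age n : (maxn N1 N2 <= n)%N -> c / 2 <= A n.
  rewrite geq_max => /andP[/hN1 h1 /hN2]; rewrite ler_norml => /andP[h2 _].
  lra.
have hA1 : Orate b (fun n => A n.+1 - W n.+1).
  case/Orate_ge0: hA => C C0 hC; exists C => n.
  rewrite (le_trans (hC _))// ler_wpM2l//.
  by rewrite ler_powR ?ler1n// lerN2 ler_wpM2r ?ler_nat// ltW.
(* A n.+1 and A n are compared through W n.+1 and W n. *)
have hd : Orate b (fun n => A n.+1 - A n).
  have := OrateD (OrateD hA1 hW) (OrateZ (-1) hA).
  rewrite (_ : (fun n => _) = (fun n => A n.+1 - A n))//.
  by apply/funext => n; ring.
case: hd => C hC; exists (maxn N1 N2), (2 / c * C) => n hn.
have h1 := Age n hn; have h2 := Age n.+1 (leqW hn).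
have a1 : 0 < A n by lra.
have a2 : 0 < A n.+1 by lra.
split => //.
have key x y : c / 2 <= x -> c / 2 <= y -> ln (y / x) <= 2 / c * `|y - x|.
  move=> hx hy; have x0 : 0 < x by lra.
  have y0 : 0 < y by lra.
  have q0 : 0 < y / x by rewrite divr_gt0.
  have hq : -1 < y / x - 1 by lra.
  have := le_ln1Dx hq; rewrite subrKC => h; rewrite (le_trans h)//.
  have -> : y / x - 1 = x^-1 * (y - x) by field; rewrite gt_eqF.
  rewrite (le_trans (ler_norm _))// normrM ler_wpM2r//.
  rewrite ger0_norm ?invr_ge0 ?(ltW x0)//.
  by rewrite -invf_div lef_pV2// ?posrE// divr_gt0.
have cd : `|A n.+1 - A n| * (2 / c) <= 2 / c * C * 2 `^ (- (n%:R * b)).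
  by rewrite mulrC -mulrA ler_wpM2l// divr_ge0// ltW.
have k1 := key _ _ h1 h2; have k2 := key _ _ h2 h1.
have e : ln (A n / A n.+1) = - ln (A n.+1 / A n).
  by rewrite !ln_div ?posrE// opprB.
rewrite e distrC in k2.
by rewrite ler_norml; apply/andP; split; lra.
Qed.

End DyadicRate.

(** * Weighted sums of centred squares *)

Section BlockSums.
Context {R : realType}.

Lemma sum_ord_mul (a b : nat) (F : nat -> R) :
  \sum_(i < a * b) F i = \sum_(p < a) \sum_(j < b) F (p * b + j)%N.
Proof.
elim: a => [|a IH]; first by rewrite mul0n !big_ord0.
rewrite big_ord_recr/= -IH mulSn addnC.
rewrite -(big_mkord xpredT F) (big_cat_nat _ (n := (a * b)%N)) ?leq_addr//= big_mkord.
congr (_ + _); rewrite -{1}[(a * b)%N]add0n big_addn addKn big_mkord.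
by apply: eq_bigr => j _; rewrite addnC.
Qed.

(** Inside a block the weight is replaced by its value at the first index. *)
Lemma weighted_block_sum (a N : nat) (w q : nat -> R) (M osc : R) :
  0 <= osc ->
  (forall p, (p < a)%N -> `|w (p * N)%N| <= M) ->
  (forall p j, (p < a)%N -> (j < N)%N -> `|w (p * N + j)%N - w (p * N)%N| <= osc) ->
  `|\sum_(i < a * N) w i * q i| <=
  M * \sum_(p < a) `|\sum_(j < N) q (p * N + j)%N| + osc * \sum_(i < a * N) `|q i|.
Proof.
move=> osc0 hM hosc.
rewrite (sum_ord_mul _ _ (fun i => w i * q i)) (sum_ord_mul _ _ (fun i => `|q i|)).
rewrite !mulr_sumr -big_split/=.
apply: le_trans (ler_norm_sum _ _ _) _; apply: ler_sum => p _.
have -> : \sum_(j < N) w (p * N + j)%N * q (p * N + j)%N =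
    w (p * N)%N * (\sum_(j < N) q (p * N + j)%N) +
    \sum_(j < N) (w (p * N + j)%N - w (p * N)%N) * q (p * N + j)%N.
  rewrite mulr_sumr -big_split/=; apply: eq_bigr => j _; ring.
rewrite (le_trans (ler_normD _ _))// lerD//.
  by rewrite normrM ler_wpM2r// hM.
apply: le_trans (ler_norm_sum _ _ _) _; rewrite mulr_sumr; apply: ler_sum => j _.
by rewrite normrM ler_wpM2r// hosc.
Qed.

End BlockSums.

Section WeightedSquares.
Context {R : realType} {disp : measure_display} {Omega : measurableType disp} {K : nat}.
Variables (T H : R) (B : R -> Omega -> 'cV[R]_K) (w : Omega).
Hypothesis T0 : 0 < T.
Hypothesis H01 : 0 < H < 1.

(** The order of magnitude of the quadratic variation on the [n]-th grid. *)
Definition variation_scale (n : nat) : R := 2 ^+ n * mesh T n `^ (2 * H).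

Lemma variation_scale_gt0 n : 0 < variation_scale n.
Proof. by rewrite mulr_gt0 ?exprn_gt0// powR_gt0// mesh_gt0. Qed.

Variable (c : 'I_K -> R).
Let v := \sum_(k < K) c k ^+ 2.
Variables (beta alpha M : R) (om : R -> R).
Hypothesis alpha0 : 0 < alpha.
Hypothesis M0 : 0 <= M.
Hypothesis omM : forall t, 0 <= t <= T -> `|om t| <= M.
Hypothesis omH : forall s t, 0 <= s -> s <= t -> t <= T ->
  `|om t - om s| <= M * (t - s) `^ alpha.
Hypothesis beta_le : beta <= (1 - hmax H) * alpha.
Hypothesis bsr : exists C : R, forall n,
  blocksum T H B c n w <= C * 2 `^ (- (n%:R * beta)) * variation_scale n.

(** The rounding in [coarse] loses at most one level, hence the factor
    [2 `^ alpha]. *)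
Lemma coarse_mesh_rate :
  Orate ((1 - hmax H) * alpha) (fun n => mesh T (coarse H n) `^ alpha).
Proof.
exists (T `^ alpha * 2 `^ alpha) => n.
rewrite ger0_norm ?powR_ge0// mesh_powR// -mulrA ler_wpM2l ?powR_ge0//.
rewrite -powRD; last by apply/implyP.
rewrite ler_powR ?ler1n//.
have := ler_wpM2r (ltW alpha0) (ltW (coarse_gt H01 n)); lra.
Qed.

Lemma mesh_le_T n : mesh T n <= T.
Proof. by rewrite /mesh ler_pdivrMr ?exprn_gt0// ler_peMr ?exprn_ege1 ?ler1n// ltW. Qed.

(** Frozen weights leave the block sums, bounded by hypothesis; the oscillation
    of the weight multiplies the sum of [|q_i|], which is of order
    [variation_scale] because [|q_i| <= q_i + 2 incr_var]. *)
Lemma weighted_square_rate :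
  Orate beta (fun n => (\sum_(i < 2 ^ n) om (dyadic T n i) *
     (dyadic_incr T B c n i w ^+ 2 - incr_var T H c n)) / variation_scale n).
Proof.
have v0 : 0 <= v by rewrite sumr_ge0// => k _; rewrite sqr_ge0.
pose osc n := M * mesh T (coarse H n) `^ alpha.
have osc0 n : 0 <= osc n by rewrite mulr_ge0// powR_ge0.
have [C hC] := bsr.
have oscT n : osc n <= M * T `^ alpha.
  have mg := ltW (mesh_gt0 T0 (coarse H n)).
  by rewrite /osc ler_wpM2l// ge0_ler_powR ?nnegrE ?mesh_le_T// ltW.
(* The block sums come with the bounded factor M + osc, the rest with osc,
   which tends to 0. *)
pose Tot n := (M + M * T `^ alpha) * (C * 2 `^ (- (n%:R * beta))) + 2 * v * osc n.
apply: (@Orate_dom _ beta _ Tot) => [n|]; last first.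
  apply: OrateD.
    by apply: OrateZ; exists `|C| => n; rewrite normrM (ger0_norm (powR_ge0 _ _)).
  apply: OrateZ; apply: OrateZ; apply: Orate_weaken coarse_mesh_rate; exact: beta_le.
have s0 := variation_scale_gt0 n.
rewrite normrM normfV (gtr0_norm s0) ler_pdivrMr//.
pose N := (2 ^ (n - coarse H n))%N; pose a := (2 ^ coarse H n)%N.
have aN : (2 ^ n = a * N)%N by rewrite -expnD subnKC ?coarse_leq.
pose q i := dyadic_incr T B c n i w ^+ 2 - incr_var T H c n.
have D0 : 0 <= blocksum T H B c n w by rewrite sumr_ge0.
have dv : incr_var T H c n * (2 ^ n)%:R = v * variation_scale n.
  by rewrite /incr_var /variation_scale natrX -/v; ring.
have qabs : \sum_(i < 2 ^ n) `|q i| <= blocksum T H B c n w + 2 * v * variation_scale n.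
  apply: (@le_trans _ _ (\sum_(i < 2 ^ n) (q i + 2 * incr_var T H c n))).
    apply: ler_sum => i _; rewrite /q ler_norml.
    have : 0 <= incr_var T H c n by rewrite mulr_ge0// powR_ge0.
    have := sqr_ge0 (dyadic_incr T B c n i w); lra.
  rewrite big_split/= sumr_const card_ord -[_ *+ _]mulr_natr -mulrA dv mulrA lerD2r.
  rewrite aN sum_ord_mul; apply: ler_sum => p _.
  exact: ler_norm.
have dy p j : (p < a)%N -> (j < N)%N -> (p * N + j < 2 ^ n)%N.
  move=> pa jN; rewrite aN.
  by rewrite (@leq_trans (p.+1 * N)%N)// ?leq_mul2r ?pa ?orbT// mulSn addnC ltn_add2r.
have NN : N%:R * mesh T n = mesh T (coarse H n).
  rewrite /mesh /N natrX.
  have -> : 2 ^+ n = 2 ^+ (n - coarse H n) * 2 ^+ coarse H n :> R.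
    by rewrite -exprD subnK ?coarse_leq.
  by field; rewrite !expf_neq0.
have Npos : (0 < N)%N by rewrite expn_gt0.
have main := @weighted_block_sum R a N (fun i => om (dyadic T n i)) q M (osc n) (osc0 n).
rewrite -aN in main.
have w1 p : (p < a)%N -> `|om (dyadic T n (p * N))| <= M.
  move=> pa; apply: omM; apply: (dyadic_in_itv T0).
  by have := dy p 0%N pa Npos; rewrite addn0 => /ltnW.
have w2 p j : (p < a)%N -> (j < N)%N ->
    `|om (dyadic T n (p * N + j)) - om (dyadic T n (p * N))| <= osc n.
  move=> pa jN.
  have h1 : 0 <= dyadic T n (p * N) by rewrite dyadicE// mulr_ge0// ltW// mesh_gt0.
  have h2 : dyadic T n (p * N) <= dyadic T n (p * N + j).
    by rewrite !dyadicE// ler_wpM2r ?ler_nat ?leq_addr// ltW// mesh_gt0.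
  have h3 : dyadic T n (p * N + j) <= T.
    by have /andP[] := dyadic_in_itv T0 (ltnW (dy p j pa jN)).
  rewrite (le_trans (omH h1 h2 h3))// /osc ler_wpM2l//.
  have mg := ltW (mesh_gt0 T0 (coarse H n)).
  rewrite ge0_ler_powR ?nnegrE ?subr_ge0 ?(ltW alpha0)// ltW//.
  rewrite -NN !dyadicE// -mulrBl ltr_pM2r ?mesh_gt0//.
  by rewrite natrD addrAC subrr add0r ltr_nat.
apply: le_trans (main w1 w2) _.
rewrite -/(blocksum T H B c n w).
have b1 := hC n.
have b2 : osc n * blocksum T H B c n w <= M * T `^ alpha * blocksum T H B c n w.
  by rewrite ler_wpM2r.
have b3 : osc n * \sum_(i < 2 ^ n) `|q i| <= osc n * (blocksum T H B c n w + 2 * v * variation_scale n).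
  by rewrite ler_wpM2l.
have b4 : (M + M * T `^ alpha) * blocksum T H B c n w <= (M + M * T `^ alpha) * (C * 2 `^ (- (n%:R * beta)) * variation_scale n).
  by rewrite ler_wpM2l// addr_ge0// mulr_ge0// powR_ge0.
rewrite /Tot; lra.
Qed.

End WeightedSquares.

(** * Riemann sums of a Hoelder function *)

Section RiemannSums.
Context {R : realType}.
Variables (T alpha M : R) (om : R -> R).
Hypothesis T0 : 0 < T.
Hypothesis alpha0 : 0 < alpha.
Hypothesis M0 : 0 <= M.
Hypothesis omH : forall s t, 0 <= s -> s <= t -> t <= T ->
  `|om t - om s| <= M * (t - s) `^ alpha.

Definition riemann_sum (n : nat) : R :=
  (2 ^+ n)^-1 * \sum_(i < 2 ^ n) om (dyadic T n i).

Let dy0 n i : 0 <= dyadic T n i.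
Proof. by rewrite dyadicE mulr_ge0// ltW// mesh_gt0. Qed.

(** Each point of the coarse grid is paired with its right neighbour on the fine
    grid. *)
Lemma riemann_sum_step :
  Orate alpha (fun n => riemann_sum n.+1 - riemann_sum n).
Proof.
apply: (@Orate_dom _ alpha _ (fun n => M * mesh T n `^ alpha)); last first.
  by apply: OrateZ; exact: Orate_mesh.
move=> n.
have p2 : 0 < 2 ^+ n.+1 :> R by rewrite exprn_gt0.
(* The points of even index cancel half of the coarse sum. *)
have e : riemann_sum n.+1 - riemann_sum n = (2 ^+ n.+1)^-1 *
    \sum_(p < 2 ^ n) (om (dyadic T n.+1 (p * 2 + 1)) - om (dyadic T n p)).
  rewrite /riemann_sum expnSr (sum_ord_mul _ _ (fun i => om (dyadic T n.+1 i))).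
  rewrite (eq_bigr (fun p : 'I_(2 ^ n) => om (dyadic T n p) + om (dyadic T n.+1 (p * 2 + 1)))).
    rewrite big_split/= sumrB exprS; field.
    by rewrite expf_neq0.
  move=> p _; rewrite !big_ord_recl big_ord0 addr0 /= addn0; congr (om _ + _).
  by rewrite /dyadic exprS natrM; field; rewrite expf_neq0.
rewrite e normrM ger0_norm ?invr_ge0 ?(ltW p2)// mulrC ler_pdivrMr//.
apply: le_trans (ler_norm_sum _ _ _) _.
apply: (@le_trans _ _ (\sum_(p < 2 ^ n) M * mesh T n `^ alpha)); last first.
  rewrite sumr_const card_ord -[leLHS]mulr_natr natrX ler_wpM2l ?mulr_ge0 ?powR_ge0//.
  by rewrite ler_weXn2l// ler1n.
apply: ler_sum => p _.
have pE : dyadic T n p = dyadic T n.+1 (p * 2).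
  by rewrite /dyadic exprS natrM; field; rewrite expf_neq0.
have h2 : dyadic T n.+1 (p * 2) <= dyadic T n.+1 (p * 2 + 1).
  by rewrite !dyadicE ler_wpM2r ?ler_nat ?leq_addr// ltW// mesh_gt0.
have h3 : dyadic T n.+1 (p * 2 + 1) <= T.
  have lt_p : (p * 2 + 1 <= 2 ^ n.+1)%N.
    by rewrite expnSr (@leq_trans (p.+1 * 2)%N)// ?leq_mul2r ?(ltn_ord p)// mulSn addnC leq_add2r.
  by have /andP[] := dyadic_in_itv T0 lt_p.
rewrite pE (le_trans (omH (dy0 _ _) h2 h3))// ler_wpM2l//.
have mg := ltW (mesh_gt0 T0 n); have mg' := mesh_gt0 T0 n.+1.
rewrite ge0_ler_powR ?nnegrE ?subr_ge0 ?(ltW alpha0)//.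
rewrite !dyadicE -mulrBl natrD addrAC subrr add0r mul1r.
by rewrite /mesh ler_wpM2l ?(ltW T0)// lef_pV2 ?posrE ?exprn_gt0// ler_weXn2l// ler1n.
Qed.

Hypothesis om_ge0 : forall t, 0 <= t <= T -> 0 <= om t.

Lemma dyadic_cover (t : R) (p : nat) : 0 <= t <= T ->
  exists2 q, (q < 2 ^ p)%N & dyadic T p q <= t <= dyadic T p q.+1.
Proof.
move=> tT; elim: p => [|p [q qp /andP[q1 q2]]].
  by exists 0%N => //; rewrite /dyadic expr0 mul0r mul1r !divr1.
have e1 : dyadic T p q = dyadic T p.+1 q.*2.
  by rewrite /dyadic exprS -muln2 natrM; field; rewrite expf_neq0.
have e2 : dyadic T p q.+1 = dyadic T p.+1 q.*2.+2.
  by rewrite /dyadic exprS -doubleS -muln2 natrM; field; rewrite expf_neq0.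
have [h|h] := leP t (dyadic T p.+1 q.*2.+1).
  exists q.*2; last by rewrite -e1 q1.
  by rewrite expnS mul2n ltn_double.
exists q.*2.+1; last by rewrite -e2 q2 ltW.
by rewrite expnS mul2n -doubleS leq_double.
Qed.

(** [om] is at least [om t0 / 2] on a dyadic interval of some level [p] around
    [t0], which carries a fixed proportion of every finer grid. *)
Lemma riemann_sum_pos (t0 : R) : 0 <= t0 <= T -> 0 < om t0 ->
  exists2 c, 0 < c & exists N, forall n, (N <= n)%N -> c <= riemann_sum n.
Proof.
move=> tT pos.
have [p hp] : exists p, M * mesh T p `^ alpha <= om t0 / 2.
  have pos2 : 0 < om t0 / 2 by rewrite divr_gt0.
  have [N hN] := Orate_eventually_le alpha0 pos2 (OrateZ M (Orate_mesh alpha T0)).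
  by exists N; rewrite (le_trans (ler_norm _))// hN.
have [q qp /andP[q1 q2]] := dyadic_cover p tT.
exists (om t0 / 2 / 2 ^+ p); first by rewrite !divr_gt0 ?exprn_gt0.
exists p => n pn.
have e2 : (2 ^ n = 2 ^ p * 2 ^ (n - p))%N by rewrite -expnD subnKC.
have dyq j : (j <= 2 ^ (n - p))%N ->
  dyadic T p q <= dyadic T n (q * 2 ^ (n - p) + j) <= dyadic T p q.+1.
  have e3 : 2 ^+ n = 2 ^+ p * 2 ^+ (n - p) :> R by rewrite -exprD subnKC.
  have f1 : 2 ^+ (n - p) != 0 :> R by rewrite expf_neq0.
  have f2 : 2 ^+ p != 0 :> R by rewrite expf_neq0.
  have eq1 q' : dyadic T p q' = (q' * 2 ^ (n - p))%:R * mesh T n.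
    by rewrite /dyadic /mesh natrM natrX e3; field; rewrite f1 f2.
  move=> jn; rewrite !eq1 dyadicE !ler_pM2r ?mesh_gt0// !ler_nat leq_addr/=.
  by rewrite mulSn addnC leq_add2r.
rewrite /riemann_sum [leRHS]mulrC ler_pdivlMr ?exprn_gt0//.
have -> : om t0 / 2 / 2 ^+ p * 2 ^+ n = (om t0 / 2) *+ 2 ^ (n - p).
  rewrite -[RHS]mulr_natr natrX -(subnKC pn) exprD subnKC//; field.
  by rewrite expf_neq0.
rewrite e2 (sum_ord_mul _ _ (fun i => om (dyadic T n i))).
have om0 (i : nat) : (i < 2 ^ n)%N -> 0 <= om (dyadic T n i).
  by move=> hi; apply: om_ge0; apply: dyadic_in_itv => //; exact: ltnW.
rewrite (bigD1 (Ordinal qp))//= -[leLHS]addr0 lerD//; last first.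
  apply: sumr_ge0 => i _; apply: sumr_ge0 => j _; apply: om0.
  rewrite e2 (@leq_trans (i.+1 * 2 ^ (n - p))%N)//.
    by rewrite mulSn addnC ltn_add2r.
  by rewrite leq_mul2r (ltn_ord i) orbT.
rewrite -[X in _ *+ X](card_ord (2 ^ (n - p))) -sumr_const; apply: ler_sum => j _.
have /andP[j1 j2] := dyq j (ltnW (ltn_ord j)).
set s := dyadic T n _ in j1 j2 *.
have q1T : dyadic T p q.+1 <= T by have /andP[] := dyadic_in_itv T0 qp.
have dist u u' : dyadic T p q <= u -> u <= u' -> u' <= dyadic T p q.+1 ->
    `|om u' - om u| <= om t0 / 2.
  move=> h1 h2 h3; rewrite (le_trans _ hp)//.
  rewrite (le_trans (omH _ h2 _))//; [exact: le_trans h1|exact: le_trans q1T|].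
  rewrite ler_wpM2l//.
  have mg := ltW (mesh_gt0 T0 p).
  rewrite ge0_ler_powR ?nnegrE ?subr_ge0 ?(ltW alpha0)//.
  have : dyadic T p q.+1 - dyadic T p q = mesh T p.
    by rewrite !dyadicE -mulrBl -natr1 addrAC subrr add0r mul1r.
  lra.
have : `|om t0 - om s| <= om t0 / 2.
  have [ts|st] := leP t0 s; first by rewrite distrC dist.
  by rewrite dist// ltW.
rewrite ler_norml => /andP[_ h]; lra.
Qed.

End RiemannSums.

(** * Decomposition of the normalised variation *)

Section HurstRate.
Context {R : realType} {disp : measure_display} {Omega : measurableType disp}.
Variables (d K : nat) (T H : R) (B : R -> Omega -> 'cV[R]_K) (w : Omega).
Variables (y : R -> 'cV[R]_d) (S : R -> 'M[R]_(d, K)).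
Variables (alpha gamma beta M : R).
Hypothesis T0 : 0 < T.
Hypothesis H01 : 0 < H < 1.
Hypothesis alpha0 : 0 < alpha.
Hypothesis beta0 : 0 < beta.
Hypothesis M0 : 0 <= M.
Hypothesis beta_alpha : beta <= (1 - hmax H) * alpha.
Hypothesis beta_cross : beta <= alpha + gamma - 2 * H.
Hypothesis beta_sharp : beta <= 2 * gamma - 2 * H.
Hypothesis SM : forall t r k, 0 <= t <= T -> `|S t r k| <= M.
Hypothesis SH : forall s t r k, 0 <= s -> s <= t -> t <= T ->
  `|S t r k - S s r k| <= M * (t - s) `^ alpha.

Let z (n i : nat) (k : 'I_K) : R := incr (B ^~ w) (dyadic T n i) (dyadic T n i.+1) k 0.
Let dy (n i : nat) (r : 'I_d) : R := incr y (dyadic T n i) (dyadic T n i.+1) r 0.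
Let noise (n i : nat) (r : 'I_d) : R := \sum_(k < K) S (dyadic T n i) r k * z n i k.

Hypothesis zM : forall n i k, (i < 2 ^ n)%N -> `|z n i k| <= M * mesh T n `^ alpha.
Hypothesis sharpM : forall n i r, (i < 2 ^ n)%N -> `|dy n i r - noise n i r| <= M * mesh T n `^ gamma.

(** The coefficients of [B^k + B^l]; on the diagonal they are those of [2 B^k],
    so that polarisation needs no case distinction. *)
Definition pair_coef (k l : 'I_K) : 'I_K -> R := fun r => (r == k)%:R + (r == l)%:R.

Hypothesis bsr : forall k l, exists C : R, forall n,
  blocksum T H B (pair_coef k l) n w <= C * 2 `^ (- (n%:R * beta)) * variation_scale T H n.

Let q (k l : 'I_K) (n i : nat) : R := dyadic_incr T B (pair_coef k l) n i w ^+ 2 - incr_var T H (pair_coef k l) n.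

Lemma sum_pair_coef (F : 'I_K -> R) k l : \sum_r pair_coef k l r * F r = F k + F l.
Proof.
under eq_bigr do rewrite mulrDl; rewrite big_split/=.
by congr (_ + _); [rewrite (bigD1 k)|rewrite (bigD1 l)] => //=;
  rewrite eqxx mul1r big1 ?addr0// => r /negbTE ->; rewrite mul0r.
Qed.

Lemma pair_coef_sq k l : \sum_r pair_coef k l r ^+ 2 = 2 + 2 * (k == l)%:R.
Proof.
under eq_bigr do rewrite expr2; rewrite sum_pair_coef /pair_coef !eqxx [l == k]eq_sym.
by case: eqP => _ /=; ring.
Qed.

Lemma dyadic_incr_pair k l n i : dyadic_incr T B (pair_coef k l) n i w = z n i k + z n i l.
Proof.
by rewrite /dyadic_incr /lincomb !sum_pair_coef /z /incr !mxE; ring.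
Qed.

(** Polarisation.  The coefficient [1/8] comes from [pair_coef k k], which gives
    [(2 B^k)^2]. *)
Lemma product_of_squares k l n i : z n i k * z n i l =
  (k == l)%:R * mesh T n `^ (2 * H) + 2^-1 * q k l n i - 8^-1 * q k k n i - 8^-1 * q l l n i.
Proof.
rewrite /q /incr_var !pair_coef_sq !dyadic_incr_pair !eqxx.
by case: eqP => _ /=; field.
Qed.

Let om (k l : 'I_K) (t : R) : R := \sum_(r < d) S t r k * S t r l.
Let Q (k l k' l' : 'I_K) (n : nat) : R :=
  (\sum_(i < 2 ^ n) om k l (dyadic T n i) * q k' l' n i) / variation_scale T H n.

Let A (n : nat) : R := scaled_variation_vec T 0 n y T / variation_scale T H n.
Let om2 (t : R) : R := \sum_(k < K) om k k t.
Let Err (n : nat) : R := (\sum_(r < d) \sum_(i < 2 ^ n) (dy n i r ^+ 2 - noise n i r ^+ 2)) / variation_scale T H n.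

Lemma scaled_variation_vec0 n :
  scaled_variation_vec T 0 n y T = \sum_(r < d) \sum_(i < 2 ^ n) dy n i r ^+ 2.
Proof.
apply: eq_bigr => r _; rewrite /scaled_variation.
apply: eq_big => [i|i _].
  by have /andP[_ ->] := dyadic_in_itv T0 (ltn_ord i).
by rewrite powRr0 mul1r /dy /incr !mxE.
Qed.

Lemma noise_sq n i : \sum_(r < d) noise n i r ^+ 2 =
  \sum_(k < K) \sum_(l < K) om k l (dyadic T n i) * (z n i k * z n i l).
Proof.
rewrite (eq_bigr (fun r => \sum_(k < K) \sum_(l < K)
   (S (dyadic T n i) r k * S (dyadic T n i) r l) * (z n i k * z n i l))); last first.
  move=> r _; rewrite expr2 /noise mulr_suml; apply: eq_bigr => k _.
  by rewrite mulr_sumr; apply: eq_bigr => l _; ring.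
rewrite exchange_big; apply: eq_bigr => k _ /=.
rewrite exchange_big; apply: eq_bigr => l _ /=.
by rewrite /om mulr_suml.
Qed.

Lemma variation_decomposition n : A n = riemann_sum T om2 n +
  \sum_(k < K) \sum_(l < K) (2^-1 * Q k l k l n - 8^-1 * Q k l k k n - 8^-1 * Q k l l l n)
  + Err n.
Proof.
have s0 := variation_scale_gt0 H T0 n; have sn0 : variation_scale T H n != 0 by rewrite gt_eqF.
have m0 : mesh T n `^ (2 * H) != 0 by rewrite gt_eqF// powR_gt0// mesh_gt0.
have -> : A n = (\sum_(i < 2 ^ n) \sum_(r < d) noise n i r ^+ 2) / variation_scale T H n + Err n.
  rewrite /A scaled_variation_vec0 /Err -mulrDl; congr (_ / _).
  rewrite [X in _ = X + _]exchange_big/= -big_split/=; apply: eq_bigr => r _.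
  by rewrite -big_split/=; apply: eq_bigr => i _; ring.
congr (_ + _).
have -> : riemann_sum T om2 n = (\sum_(k < K) \sum_(l < K) \sum_(i < 2 ^ n)
     om k l (dyadic T n i) * ((k == l)%:R * mesh T n `^ (2 * H))) / variation_scale T H n.
  rewrite /riemann_sum /variation_scale /om2 exchange_big/= mulr_sumr mulr_suml.
  apply: eq_bigr => k _; rewrite (bigD1 k)//= [X in _ + X]big1 ?addr0; last first.
    move=> l /negbTE lk; rewrite big1// => i _.
    by rewrite eq_sym lk mul0r mulr0.
  rewrite eqxx -mulr_suml mul1r; field.
  by rewrite m0 expf_neq0.
have -> : \sum_(i < 2 ^ n) \sum_(r < d) noise n i r ^+ 2 =
    \sum_(k < K) \sum_(l < K) \sum_(i < 2 ^ n) om k l (dyadic T n i) * (z n i k * z n i l).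
  rewrite (eq_bigr (fun i : 'I_(2 ^ n) => \sum_(k < K) \sum_(l < K)
      om k l (dyadic T n i) * (z n i k * z n i l))); last by move=> i _; exact: noise_sq.
  by rewrite exchange_big/=; apply: eq_bigr => k _; rewrite exchange_big.
rewrite !mulr_suml -big_split/=; apply: eq_bigr => k _.
rewrite !mulr_suml -big_split/=; apply: eq_bigr => l _.
have -> : \sum_(i < 2 ^ n) om k l (dyadic T n i) * (z n i k * z n i l) =
    \sum_(i < 2 ^ n) om k l (dyadic T n i) * ((k == l)%:R * mesh T n `^ (2 * H)) +
    (2^-1 * (\sum_(i < 2 ^ n) om k l (dyadic T n i) * q k l n i)
     - 8^-1 * (\sum_(i < 2 ^ n) om k l (dyadic T n i) * q k k n i)
     - 8^-1 * (\sum_(i < 2 ^ n) om k l (dyadic T n i) * q l l n i)).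
  rewrite !mulr_sumr -!sumrB -big_split/=; apply: eq_bigr => i _.
  by rewrite product_of_squares; ring.
by rewrite /Q; ring.
Qed.

Lemma om_bound k l t : 0 <= t <= T -> `|om k l t| <= d%:R * M ^+ 2.
Proof.
move=> tT; rewrite (le_trans (ler_norm_sum _ _ _))//.
apply: (@le_trans _ _ (\sum_(r < d) M ^+ 2)).
  by apply: ler_sum => r _; rewrite normrM expr2 ler_pM// SM.
by rewrite sumr_const card_ord mulr_natl.
Qed.

Lemma om_holder k l s t : 0 <= s -> s <= t -> t <= T ->
  `|om k l t - om k l s| <= (2 * d%:R * M ^+ 2) * (t - s) `^ alpha.
Proof.
move=> s0 st tT; rewrite /om -sumrB (le_trans (ler_norm_sum _ _ _))//.
apply: (@le_trans _ _ (\sum_(r < d) 2 * M ^+ 2 * (t - s) `^ alpha)); last first.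
  by rewrite sumr_const card_ord -[leLHS]mulr_natl !mulrA [d%:R * 2]mulrC.
apply: ler_sum => r _.
have sT : 0 <= s <= T by rewrite s0 (le_trans st).
have tT' : 0 <= t <= T by rewrite (le_trans s0 st).
have -> : S t r k * S t r l - S s r k * S s r l =
  S t r k * (S t r l - S s r l) + (S t r k - S s r k) * S s r l by ring.
rewrite (le_trans (ler_normD _ _))// !normrM.
have h1 : `|S t r k| * `|S t r l - S s r l| <= M * (M * (t - s) `^ alpha).
  by rewrite ler_pM// ?SM// SH.
have h2 : `|S t r k - S s r k| * `|S s r l| <= (M * (t - s) `^ alpha) * M.
  by rewrite ler_pM// ?SM// SH.
lra.
Qed.

Lemma Q_rate k l k' l' : Orate beta (Q k l k' l').
Proof.
have M2 : 0 <= 2 * d%:R * M ^+ 2 by rewrite !mulr_ge0.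
apply: (@weighted_square_rate _ _ _ _ T H B w T0 H01 (pair_coef k' l') beta alpha _ (om k l) alpha0 M2).
- move=> t tT; rewrite (le_trans (om_bound k l tT))// ler_wpM2r ?sqr_ge0//.
  by rewrite ler_peMl// ler1n.
- exact: om_holder.
- exact: beta_alpha.
- exact: bsr.
Qed.

(** The difference of two squares, [2 noise e + e^2] with [e] of order
    [mesh^gamma], over [2^n] intervals. *)
Lemma Err_rate : Orate beta Err.
Proof.
pose E n := (2 * (K%:R * M * (M * mesh T n `^ alpha)) * (M * mesh T n `^ gamma)
   + (M * mesh T n `^ gamma) ^+ 2) * mesh T n `^ (- (2 * H)).
apply: (@Orate_dom _ beta _ (fun n => d%:R * E n)); last first.
  apply: OrateZ.
  have rg := Orate_mesh gamma T0; have ra := Orate_mesh alpha T0.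
  have rH := Orate_mesh (- (2 * H)) T0.
  rewrite (_ : E = fun n =>
    (2 * K%:R * M ^+ 3) * (mesh T n `^ alpha * mesh T n `^ gamma * mesh T n `^ (- (2 * H)))
    + M ^+ 2 * (mesh T n `^ gamma * mesh T n `^ gamma * mesh T n `^ (- (2 * H)))).
    apply: OrateD; apply: OrateZ.
    + by apply: Orate_weaken (OrateM (OrateM ra rg) rH).
    + apply: Orate_weaken (OrateM (OrateM rg rg) rH).
      by have := beta_sharp; rewrite mulr_natl mulr2n.
  by apply/funext => n; rewrite /E; ring.
move=> n; have s0 := variation_scale_gt0 H T0 n.
rewrite normrM normfV (gtr0_norm s0) ler_pdivrMr//.
have -> : d%:R * E n * variation_scale T H n = \sum_(r < d) \sum_(i < 2 ^ n)
   (2 * (K%:R * M * (M * mesh T n `^ alpha)) * (M * mesh T n `^ gamma)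
   + (M * mesh T n `^ gamma) ^+ 2).
  rewrite !sumr_const !card_ord -mulrnA -[RHS]mulr_natr natrM natrX.
  rewrite /E /variation_scale powRN; field.
  by rewrite gt_eqF// powR_gt0// mesh_gt0.
rewrite (le_trans (ler_norm_sum _ _ _))//; apply: ler_sum => r _.
rewrite (le_trans (ler_norm_sum _ _ _))//; apply: ler_sum => i _.
have h1 := sharpM r (ltn_ord i).
have ti : 0 <= dyadic T n i <= T by apply: dyadic_in_itv => //; exact: ltnW.
have h2 : `|noise n i r| <= K%:R * M * (M * mesh T n `^ alpha).
  rewrite (le_trans (ler_norm_sum _ _ _))//.
  apply: (@le_trans _ _ (\sum_(k < K) M * (M * mesh T n `^ alpha))).
    by apply: ler_sum => k _; rewrite normrM ler_pM// ?SM// zM.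
  by rewrite sumr_const card_ord -[leLHS]mulr_natl mulrA.
have -> : dy n i r ^+ 2 - noise n i r ^+ 2 =
  2 * noise n i r * (dy n i r - noise n i r) + (dy n i r - noise n i r) ^+ 2 by ring.
rewrite (le_trans (ler_normD _ _))// lerD//.
  by rewrite !normrM (ger0_norm (ler0n _ 2)) ler_pM// ?mulr_ge0// ler_wpM2l.
by rewrite normrX ler_pXn2r// nnegrE// (le_trans _ h1).
Qed.

Hypothesis Snz : exists2 t0, 0 <= t0 <= T & S t0 != 0.

(** [variation_scale] is multiplied by [2^(1 - 2 H)] from one level to the next,
    which turns the estimator into a logarithm of the ratio of consecutive
    normalised variations. *)
Theorem hurst_rate : exists N (C : R), forall n, (N <= n)%N ->
  `|H - hurst_estimator T y n| <= C * 2 `^ (- (n%:R * beta)).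
Proof.
have K2 : 0 <= K%:R * (2 * d%:R * M ^+ 2) by rewrite !mulr_ge0.
have om2H s t : 0 <= s -> s <= t -> t <= T ->
    `|om2 t - om2 s| <= K%:R * (2 * d%:R * M ^+ 2) * (t - s) `^ alpha.
  move=> s0 st tT; rewrite /om2 -sumrB (le_trans (ler_norm_sum _ _ _))//.
  apply: (@le_trans _ _ (\sum_(k < K) (2 * d%:R * M ^+ 2) * (t - s) `^ alpha)).
    by apply: ler_sum => k _; exact: om_holder.
  by rewrite sumr_const card_ord -[leLHS]mulr_natl mulrA.
have omkk0 k t : 0 <= om k k t by apply: sumr_ge0 => r _; rewrite -expr2 sqr_ge0.
have om2_ge0 t : 0 <= om2 t by apply: sumr_ge0.
have [t0 t0T St0] := Snz.
have om2_pos : 0 < om2 t0.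
  have [r [k rk]] : exists r k, S t0 r k != 0.
    apply: contrapT => h; move/eqP: St0; apply; apply/matrixP => r k.
    rewrite mxE; apply/eqP/negP => /negP hn; apply: h; by exists r, k.
  rewrite /om2 (bigD1 k)//= ltr_wpDr ?sumr_ge0// /om (bigD1 r)//= ltr_wpDr//.
    by apply: sumr_ge0 => r' _; rewrite -expr2 sqr_ge0.
  by rewrite -expr2 exprn_even_gt0.
have [c c0 hc] := riemann_sum_pos T0 alpha0 K2 om2H (fun t _ => om2_ge0 t) t0T om2_pos.
have rA : Orate beta (fun n => A n - riemann_sum T om2 n).
  rewrite (_ : (fun n => _) = fun n =>
    (\sum_(k < K) \sum_(l < K) (2^-1 * Q k l k l n + (- 8^-1) * Q k l k k n + (- 8^-1) * Q k l l l n))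
    + Err n); last first.
    apply/funext => n; rewrite variation_decomposition.
    rewrite addrAC [X in X + _](_ : _ = \sum_(k < K) \sum_(l < K)
      (2^-1 * Q k l k l n - 8^-1 * Q k l k k n - 8^-1 * Q k l l l n)); last by ring.
    by congr (_ + _); apply: eq_bigr => k _; apply: eq_bigr => l _; ring.
  apply: OrateD; last exact: Err_rate.
  apply: Orate_sum => k; apply: Orate_sum => l.
  by apply: OrateD; [apply: OrateD|]; apply: OrateZ; exact: Q_rate.
have h01 : 0 < 1 - hmax H <= 1.
  case/andP: H01 => H0 H1; rewrite subr_gt0 /hmax gt_max H1 invf_lt1// ltr1n/=.
  by rewrite gerBl le_max invr_ge0 ler0n.
have rW : Orate beta (fun n => riemann_sum T om2 n.+1 - riemann_sum T om2 n).
  apply: Orate_weaken (riemann_sum_step T0 alpha0 K2 om2H).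
  rewrite (le_trans beta_alpha)// ler_piMl ?(ltW alpha0)//.
  by case/andP: h01.
have [N [C hC]] := ln_ratio_rate beta0 c0 hc rA rW.
exists N, (C / (2 * ln 2)) => n /hC [a1 a2 hln].
have ln2 : 0 < ln 2 :> R by rewrite ln_gt0// ltr1n.
have s1 := variation_scale_gt0 H T0 n; have s2 := variation_scale_gt0 H T0 n.+1.
have VE m : scaled_variation_vec T 0 m y T = A m * variation_scale T H m.
  by rewrite /A mulfVK// gt_eqF// variation_scale_gt0.
have ratio : variation_scale T H n.+1 / variation_scale T H n = 2 `^ (1 - 2 * H).
  rewrite /variation_scale !mesh_powR// powRB; last by apply/implyP.
  rewrite powRr1// exprS.
  have -> : 2 `^ (- (n.+1%:R * (2 * H))) = 2 `^ (- (n%:R * (2 * H))) / 2 `^ (2 * H) :> R.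
    rewrite -powRB; last by apply/implyP.
    by congr (_ `^ _); rewrite -natr1; ring.
  field.
  by rewrite expf_neq0// !gt_eqF// powR_gt0.
have lnS : ln (S_ratio T y n) = ln (A n.+1 / A n) + (1 - 2 * H) * ln 2.
  have p1 : A n.+1 / A n \is Num.pos by rewrite posrE; exact: divr_gt0.
  have p2 : variation_scale T H n.+1 / variation_scale T H n \is Num.pos by rewrite posrE divr_gt0.
  rewrite /S_ratio !VE -ln_powR -ratio -lnM//.
  by congr ln; field; rewrite !gt_eqF.
have -> : H - hurst_estimator T y n = ln (A n.+1 / A n) / (2 * ln 2).
  rewrite /hurst_estimator lnS; field.
  by rewrite gt_eqF.
rewrite normrM (ger0_norm (_ : 0 <= (2 * ln 2)^-1)) ?invr_ge0 ?mulr_ge0 ?(ltW ln2)//.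
by rewrite [leRHS]mulrAC ler_wpM2r ?invr_ge0 ?mulr_ge0 ?(ltW ln2).
Qed.

End HurstRate.

(** * Regularity of the coefficients along a path *)

Section HolderBounds.
Context {R : realType} {V : normedModType R}.
Implicit Types (T a : R) (x : R -> V) (f : R -> R -> V).

Lemma holder2_bound T a f : holder2 T a f ->
  exists2 M, 0 <= M & forall s t, 0 <= s -> s < t -> t <= T ->
    `|f s t| <= M * (t - s) `^ a.
Proof.
rewrite /holder2 => h; have [lty|] := leP (holder_seminorm2 T a f) 0%E.
  exists 0 => // s t s0 st tT.
  have : ((`|f s t| / (t - s) `^ a)%:E <= 0)%E.
    apply: le_trans lty; apply: ereal_sup_ubound; exists s, t; by split.
  rewrite lee_fin mul0r pmulr_lle0// invr_gt0 powR_gt0// subr_gt0//.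
move=> pos; exists (fine (holder_seminorm2 T a f)).
  by rewrite fine_ge0// ltW.
move=> s t s0 st tT; rewrite -ler_pdivrMr ?powR_gt0 ?subr_gt0//.
rewrite -lee_fin fineK; last by rewrite ge0_fin_numE// ltW.
by apply: ereal_sup_ubound; exists s, t; split.
Qed.

Lemma holder_bound T a x : 0 < T -> holder T a x ->
  exists2 M, 0 <= M & (forall t, 0 <= t <= T -> `|x t| <= M) /\
   (forall s t, 0 <= s -> s <= t -> t <= T -> `|x t - x s| <= M * (t - s) `^ a).
Proof.
rewrite /holder /holder_norm => T0 h.
have sup0 : (0 <= sup_norm T x)%E.
  apply: (@le_trans _ _ (`|x 0|)%:E); first by rewrite lee_fin.
  by apply: ereal_sup_ubound; exists 0; rewrite lexx ltW.
have semi0 : (0 <= holder_seminorm2 T a (incr x))%E.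
  apply: (@le_trans _ _ (`|incr x 0 T| / (T - 0) `^ a)%:E).
    by rewrite lee_fin divr_ge0// powR_ge0.
  by apply: ereal_sup_ubound; exists 0, T; rewrite lexx.
have sup_fin : (sup_norm T x < +oo)%E.
  by rewrite (le_lt_trans _ h)// leeDl.
have semi_fin : holder2 T a (incr x).
  by rewrite /holder2 (le_lt_trans _ h)// leeDr.
have [M M0 hM] := holder2_bound semi_fin.
have sfin : sup_norm T x \is a fin_num by rewrite ge0_fin_numE.
exists (Num.max (fine (sup_norm T x)) M); first by rewrite le_max M0 orbT.
split=> [t /andP[t0 tT]|s t s0 st tT].
  rewrite le_max; apply/orP; left; rewrite -lee_fin fineK//.
  by apply: ereal_sup_ubound; exists t; split.
have [<-|ne] := eqVneq s t.
  by rewrite subrr normr0 mulr_ge0 ?powR_ge0// le_max M0 orbT.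
have lt_st : s < t by rewrite lt_neqAle ne.
rewrite (le_trans (hM s t s0 lt_st tT))// ler_wpM2r ?powR_ge0//.
by rewrite le_max lexx orbT.
Qed.

End HolderBounds.

Section MatrixNorm.
Context {R : realType}.

Lemma mx_entry_le m n (x : 'M[R]_(m, n)) i j : `|x i j| <= `|x|.
Proof.
rewrite [leRHS]/Num.Def.normr/= mx_normrE.
by apply/bigmax_geP; right => /=; exists (i, j).
Qed.

Lemma mx_norm_le m n (x : 'M[R]_(m, n)) M : 0 <= M ->
  (forall i j, `|x i j| <= M) -> `|x| <= M.
Proof.
move=> M0 h; rewrite [leLHS]/Num.Def.normr/= mx_normrE.
by apply/bigmax_leP; split => // -[i j] _; exact: h.
Qed.

Lemma trmx_norm m n (x : 'M[R]_(m, n)) : `|x^T| = `|x|.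
Proof.
apply/eqP; rewrite eq_le; apply/andP; split; apply: mx_norm_le => // i j.
  by rewrite mxE mx_entry_le.
by have := mx_entry_le x^T j i; rewrite mxE.
Qed.

(** Transposition carries compactness from rows to columns. *)
Lemma trmx_continuous m n : continuous (fun x : 'M[R]_(m, n) => x^T).
Proof.
move=> x; apply/(@cvgrPdist_le _ _ _ _ (nbhs_filter x)) => e e0.
have /cvgrPdist_le /(_ e e0) := @cvg_id _ (nbhs x).
by apply: filterS => z; rewrite -raddfB /= trmx_norm.
Qed.

Lemma cV_box_compact n (M : R) : compact [set x : 'cV[R]_n | forall i, `|x i 0| <= M].
Proof.
have c1 : compact [set v : 'rV[R]_n | forall i, `[- M, M]%classic (v ord0 i)].
  by apply: (@rV_compact R n (fun=> `[- M, M]%classic)) => i; exact: segment_compact.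
have := continuous_compact (continuous_subspaceT (@trmx_continuous 1 n)) c1.
congr (compact _); apply/seteqP; split => x /=.
  move=> [v hv <-] i; rewrite mxE; have := hv i.
  by rewrite /= in_itv/= ler_norml.
move=> hx; exists x^T; last by rewrite trmxK.
by move=> i; rewrite /= in_itv/= mxE -ler_norml.
Qed.

Lemma continuous_box_bounded n (f : 'cV[R]_n -> R) (M : R) : continuous f ->
  exists2 L : R, 0 <= L & forall x : 'cV[R]_n, (forall i, `|x i 0| <= M) -> `|f x| <= L.
Proof.
move=> cf.
have := continuous_compact (continuous_subspaceT cf) (@cV_box_compact n M).
move=> /compact_bounded /pinfty_ex_gt0 [L L0 hL].
exists L; first exact: ltW.
by move=> x hx; apply: hL; exists x.
Qed.

End MatrixNorm.

Section LocallyLipschitz.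
Context {R : realType} {d : nat}.
Implicit Types (f : 'cV[R]_d -> R) (x z v : 'cV[R]_d).

(** The difference quotients of the two sides are the same functions. *)
Lemma is_derive_coord f j v (s : R) :
  derivable f (v + s *: delta_mx j 0) (delta_mx j 0) ->
  is_derive s 1 (fun h => f (v + h *: delta_mx j 0)) (partial j f (v + s *: delta_mx j 0)).
Proof.
move=> df.
have e : (fun h : R => h^-1 *: (((fun h => f (v + h *: delta_mx j 0)) \o shift s) (h *: 1)
            - f (v + s *: delta_mx j 0))) =
  (fun h : R => h^-1 *: ((f \o shift (v + s *: delta_mx j 0)) (h *: delta_mx j 0)
            - f (v + s *: delta_mx j 0))).
  apply/funext => h /=; congr (_ *: (f _ - _)).
  by rewrite /GRing.scale/= mulr1 -/(GRing.scale _ _) scalerDl addrCA.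
by apply: DeriveDef; [rewrite /derivable e|rewrite /derive e].
Qed.

(** The box is convex in each coordinate, so the mean value theorem applies
    along the segment. *)
Lemma coord_increment f j (L M : R) v (a : R) :
  (forall x, derivable f x (delta_mx j 0)) ->
  (forall x, (forall i, `|x i 0| <= M) -> `|partial j f x| <= L) ->
  (forall i, `|v i 0| <= M) -> (forall i, `|(v + a *: delta_mx j 0) i 0| <= M) ->
  `|f (v + a *: delta_mx j 0) - f v| <= L * `|a|.
Proof.
move=> df hL hv hva.
pose phi h := f (v + h *: delta_mx j 0).
have dphi (s : R) : is_derive s 1 phi (partial j f (v + s *: delta_mx j 0)).
  exact: is_derive_coord.
have cphi (b c : R) : {within `[b, c], continuous phi}.
  apply: continuous_subspaceT => s.
  by apply/differentiable_continuous/derivable1_diffP; exact: ex_derive.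
have inbox (s : R) : Num.min 0 a <= s <= Num.max 0 a ->
    forall i, `|(v + s *: delta_mx j 0) i 0| <= M.
  move=> hs i; have := hv i; have := hva i.
  rewrite !mxE; case: (i == j) => /=; rewrite ?andbT ?mulr1 ?mulr0 ?addr0//.
  rewrite !ler_norml => /andP[h1 h2] /andP[h3 h4].
  move: hs; rewrite ge_min le_max => /andP[/orP[a1|a1] /orP[a2|a2]];
    apply/andP; split; lra.
have -> : f v = phi 0 by rewrite /phi scale0r addr0.
rewrite -/(phi a).
have [a0|a0] := leP 0 a.
  have [c] := MVT_segment a0 (fun s _ => dphi s) (@cphi 0 a).
  rewrite in_itv/= => /andP[c0 ca] ->; rewrite subr0 normrM ler_wpM2r//.
  by apply: hL; apply: inbox; rewrite ge_min le_max c0 ca orbT.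
have [c] := MVT_segment (ltW a0) (fun s _ => dphi s) (@cphi a 0).
rewrite in_itv/= => /andP[ca c0] e; rewrite distrC e sub0r normrM normrN ler_wpM2r//.
by apply: hL; apply: inbox; rewrite ge_min le_max c0 ca orbT.
Qed.

(** Go from [z] to [x] by changing one coordinate at a time; all intermediate
    points stay in the box, where the partial derivatives are bounded. *)
Lemma class_C1_lipschitz f (M : R) : class_C 1 f ->
  exists2 L : R, 0 <= L & forall x z : 'cV[R]_d, (forall i, `|x i 0| <= M) -> (forall i, `|z i 0| <= M) ->
    `|f x - f z| <= L * `|x - z|.
Proof.
move=> [cf hf].
have hL j : exists L : R, 0 <= L /\ forall x : 'cV[R]_d, (forall i, `|x i 0| <= M) -> `|partial j f x| <= L.
  have [_ cp] := hf j.
  by have [L L0 h] := continuous_box_bounded M cp; exists L.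
have [L hL'] := choice hL.
exists (\sum_j L j); first by apply: sumr_ge0 => j _; have [] := hL' j.
move=> x z hx hz.
(* The first m coordinates come from x, the others from z. *)
pose v (m : nat) : 'cV[R]_d := \col_i (if (i < m)%N then x i 0 else z i 0).
have v0 : v 0%N = z by apply/colP => i; rewrite mxE.
have vd : v d = x by apply/colP => i; rewrite mxE ltn_ord.
have hv m i : `|v m i 0| <= M by rewrite mxE; case: ifP.
have step (j : 'I_d) : `|f (v j.+1) - f (v j)| <= L j * `|x - z|.
  have e : v j.+1 = v j + (x j 0 - z j 0) *: delta_mx j 0.
    apply/colP => i; rewrite !mxE ltnS leq_eqVlt.
    have [ij|ij] := eqVneq (i : nat) j.
      have -> : i = j by apply: val_inj.
      by rewrite ltnn eqxx/= mulr1 subrKC.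
    rewrite (_ : (i == j) = false); last by apply/negbTE.
    by rewrite /= mulr0 addr0.
  have [L0 hLj] := hL' j.
  rewrite e (le_trans (coord_increment _ hLj _ _))//.
  - by have [] := hf j.
  - by move=> i; rewrite -e.
  - rewrite ler_wpM2l//; have := mx_entry_le (x - z) j 0.
    by rewrite !mxE.
have -> : f x - f z = \sum_(j < d) (f (v j.+1) - f (v j)).
  rewrite -(big_mkord xpredT (fun m => f (v m.+1) - f (v m))).
  by rewrite telescope_sumr// vd v0.
rewrite (le_trans (ler_norm_sum _ _ _))// mulr_suml.
by apply: ler_sum => j _.
Qed.

End LocallyLipschitz.

Section Drift.
Context {R : realType} {d : nat}.
Variables (T a : R) (u : R -> 'cV[R]_d -> 'cV[R]_d) (y : R -> 'cV[R]_d).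
Hypothesis T0 : 0 < T.
Hypothesis a0 : 0 < a.
Hypothesis hy : holder T a y.
Hypothesis cu : {within [set p : R * 'cV[R]_d | 0 <= p.1 <= T],
  continuous (fun p => u p.1 p.2)}.

Let clamp (r : R) : R := Num.max 0 (Num.min r T).

Let clamp_itv r : 0 <= clamp r <= T.
Proof. by rewrite /clamp le_max lexx/= ge_max (ltW T0)/= ge_min lexx orbT. Qed.

Let clampK r : 0 <= r <= T -> clamp r = r.
Proof. by move=> /andP[r0 rT]; rewrite /clamp (min_idPl rT) (max_idPr r0). Qed.

Let clamp_cases r : [\/ r <= 0 /\ clamp r = 0,
  0 <= r <= T /\ clamp r = r | T <= r /\ clamp r = T].
Proof.
have [rT|Tr] := leP r T; last first.
  by apply: Or33; split; [exact: ltW|rewrite /clamp (min_idPr (ltW Tr)) (max_idPr (ltW T0))].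
have [r0|r0] := leP 0 r.
  have rr : 0 <= r <= T by rewrite r0 rT.
  by apply: Or32; rewrite clampK.
by apply: Or31; split; [exact: ltW|rewrite /clamp (min_idPl rT) (max_idPl (ltW r0))].
Qed.

Let clamp_lip r s : `|clamp r - clamp s| <= `|r - s|.
Proof.
have h1 := ler_norm (r - s); have h2 := ler_norm (s - r); rewrite distrC in h2.
have h3 := clamp_itv r; have h4 := clamp_itv s.
rewrite ler_norml; apply/andP.
by case: (clamp_cases r) => -[a1 a2]; case: (clamp_cases s) => -[b1 b2];
  rewrite ?a2 ?b2 in h3 h4 *; split; lra.
Qed.

Let clamp_cont : continuous clamp.
Proof.
move=> r; apply/cvgrPdist_le => e e0; near=> s.
rewrite (le_trans (clamp_lip r s))//; near: s; exact: cvgr_dist_le.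
Unshelve. all: by end_near. Qed.

Let yclamp_cont : continuous (y \o clamp).
Proof.
have [M M0 [_ hM]] := holder_bound T0 hy.
have hM' s t : 0 <= s <= T -> 0 <= t <= T -> `|y t - y s| <= M * `|t - s| `^ a.
  move=> /andP[s0 sT] /andP[t0 tT]; have [st|ts] := leP s t.
    by rewrite [X in _ * X `^ _]ger0_norm ?subr_ge0// hM.
  by rewrite distrC [X in _ * X `^ _]distrC [X in _ * X `^ _]gtr0_norm ?subr_gt0// hM// ltW.
move=> r; apply/(@cvgrPdist_le _ _ _ _ (nbhs_filter r)) => e e0.
pose del := (e / (M + 1)) `^ a^-1.
have M1 : 0 < M + 1 by rewrite ltr_pwDr.
have del0 : 0 < del by rewrite powR_gt0// divr_gt0.
near=> s; rewrite /= (le_trans (hM' _ _ (clamp_itv s) (clamp_itv r)))//.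
have : `|clamp r - clamp s| <= del.
  by rewrite (le_trans (clamp_lip r s))//; near: s; exact: cvgr_dist_le.
move=> h; apply: (@le_trans _ _ (M * del `^ a)).
  by rewrite ler_wpM2l// ge0_ler_powR ?nnegrE// ltW.
have -> : del `^ a = e / (M + 1).
  by rewrite /del -powRrM mulVf ?gt_eqF// powRr1// divr_ge0// ltW.
by rewrite mulrA ler_pdivrMr// mulrC ler_pM2l// lerDl.
Unshelve. all: by end_near. Qed.

Let G (i : 'I_d) (r : R) : R := u (clamp r) (y (clamp r)) i 0.

Let G_cont i : continuous (G i).
Proof.
move=> r.
have c1 : (fun p : R * 'cV[R]_d => u p.1 p.2) \o (fun s => (clamp s, y (clamp s))) @ nbhs r
    --> u (clamp r) (y (clamp r)).
  move/subspace_continuousP : cu => /(_ (clamp r, y (clamp r)) (clamp_itv r)).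
  move=> h; apply: cvg_trans h.
  move=> P; rewrite /within /=.
  move=> hP.
  have cp : (fun s => (clamp s, y (clamp s))) @ nbhs r --> (clamp r, y (clamp r)).
    exact: (@cvg_pair _ _ _ _ _ _ (nbhs_filter r) (nbhs_filter _) (nbhs_filter _)
      _ _ (clamp_cont (x:=r)) (yclamp_cont (x:=r))).
  have near_r : \forall s \near r, 0 <= clamp s <= T -> P (u (clamp s) (y (clamp s))).
    exact: (cp _ hP).
  suff : \forall s \near r, P (u (clamp s) (y (clamp s))) by [].
  by apply: filterS near_r => s; apply; exact: clamp_itv.
exact: (cvg_comp _ _ c1 (@coord_continuous R d 1 i 0 (u (clamp r) (y (clamp r))))).
Qed.

(** Clamping the time to [[0, T]] extends [r |-> u r (y r)] to a continuous
    function on the line, which is bounded on [[0, T]]. *)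
Lemma drift_bound : exists2 M : R, 0 <= M & forall (s t : R) i,
  0 <= s -> s <= t -> t <= T -> `|drift u y s t i 0| <= M * (t - s).
Proof.
have hL i : exists L : R, 0 <= L /\ forall r, 0 <= r <= T -> `|G i r| <= L.
  have := continuous_compact (continuous_subspaceT (@G_cont i)) (@segment_compact R 0 T).
  move=> /compact_bounded /pinfty_ex_gt0 [L L0 hL].
  exists L; split; first exact: ltW.
  by move=> r hr; apply: hL; exists r.
have [L hL'] := choice hL.
exists (\sum_i L i); first by apply: sumr_ge0 => i _; have [] := hL' i.
move=> s t i s0 st tT; rewrite /drift mxE.
have -> : \int[lebesgue_measure]_(r in `[s, t]) u r (y r) i 0 =
   \int[lebesgue_measure]_(r in `[s, t]) G i r.
  apply: eq_Rintegral => r; rewrite inE/= in_itv/= => /andP[sr rt].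
  by rewrite /G clampK// (le_trans s0 sr) (le_trans rt).
have iG : lebesgue_measure.-integrable `[s, t] (EFin \o G i).
  by apply: continuous_compact_integrable; [exact: segment_compact|exact: (continuous_subspaceT (@G_cont i))].
have mst : measurable (`[s, t] : set R) by exact: measurable_itv.
rewrite (le_trans (le_normr_Rintegral _ iG))//.
apply: (@le_trans _ _ (\int[lebesgue_measure]_(r in `[s, t]) L i)).
  apply: le_Rintegral => //.
  - exact: integrable_abse iG.
  - by apply: continuous_compact_integrable; [exact: segment_compact|apply: continuous_subspaceT; exact: cst_continuous].
  - move=> r /=; rewrite in_itv/= => /andP[sr rt].
    by have [_] := hL' i; apply; rewrite (le_trans s0 sr) (le_trans rt).
have lm : lebesgue_measure (`[s, t]%classic : set R) = (t - s)%:E.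
  rewrite lebesgue_measure_itv/= lte_fin; case: ltP => //= ts.
  by have -> : s = t; [apply/eqP; rewrite eq_le st|rewrite subrr].
have -> : \int[lebesgue_measure]_(r in `[s, t]) L i = L i * (t - s).
  by rewrite Rintegral_cst//; congr (_ * _); exact: (congr1 fine lm).
rewrite ler_wpM2r ?subr_ge0//.
rewrite (bigD1 i)//= lerDl; apply: sumr_ge0 => j _; by have [] := hL' j.
Qed.

End Drift.

(** * Comparison with the rate in the theorem *)

Section Delta.
Context {R : realType}.
Variables (H : R).
Hypothesis H01 : 0 < H < 1.

Lemma hmax_itv : 0 < 1 - hmax H < 1.
Proof.
case/andP: H01 => H0 H1; rewrite subr_gt0 /hmax gt_max H1 invf_lt1// ltr1n/=.
by rewrite gtrBl lt_max invr_gt0 ltr0n.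
Qed.

Lemma deltaE n : delta H n = 2 `^ (- (n%:R * (1 - hmax H))) * Num.sqrt n%:R.
Proof.
rewrite /delta /hmax; case: leP => h.
  by congr (2 `^ (- _) * _); congr (_ * _); lra.
by [].
Qed.

(** [sqrt n <= n] is beaten by the exponential, through [1 + x <= exp x]. *)
Lemma delta_bounded : exists2 D : R, 0 < D & forall n, delta H n <= D.
Proof.
have /andP[g0 _] := hmax_itv; set g := 1 - hmax H in g0.
have ln2 : 0 < ln 2 :> R by rewrite ln_gt0// ltr1n.
have gl : 0 < g * ln 2 by rewrite mulr_gt0.
exists (g * ln 2)^-1; first by rewrite invr_gt0.
move=> n; rewrite deltaE -/g powRN mulrC ler_pdivrMr ?powR_gt0// ler_pdivlMl//.
apply: (@le_trans _ _ (g * ln 2 * n%:R)).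
  rewrite ler_wpM2l ?(ltW gl)//.
  case: n => [|n]; first by rewrite sqrtr0.
  rewrite -[leRHS]sqr_sqrtr// expr2 ler_peMl ?sqrtr_ge0//.
  by rewrite -[leLHS]sqrtr1 ler_sqrt ?ler1n.
apply: (@le_trans _ _ (expR (n%:R * g * ln 2))).
  have := expR_ge1Dx (n%:R * g * ln 2); rewrite (_ : g * ln 2 * n%:R = n%:R * g * ln 2); first lra.
  by ring.
by rewrite /powR pnatr_eq0/=.
Qed.

(** For [e >= 0] the factor [sqrt n] only helps; for [e < 0] the right-hand side
    is bounded below while the left-hand side tends to [0]. *)
Lemma rate_le_delta (p e C : R) : 0 < p -> e < p ->
  exists N, forall n, (N <= n)%N ->
    C * 2 `^ (- (n%:R * ((1 - hmax H) * p))) <= delta H n `^ e.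
Proof.
move=> p0 ep; have /andP[g0 _] := hmax_itv; set g := 1 - hmax H in g0 *.
have rate b : Orate b (fun n => C * 2 `^ (- (n%:R * b))).
  by exists `|C| => n; rewrite normrM ler_wpM2l// ger0_norm// powR_ge0.
have [e0|e0] := leP 0 e.
  have gb : 0 < g * (p - e) by rewrite mulr_gt0// subr_gt0.
  have [N hN] := Orate_eventually_le gb ltr01 (rate _).
  exists N.+1 => n Nn; have := hN n (ltnW Nn) => /(le_trans (ler_norm _)) h.
  rewrite deltaE -/g powRM ?powR_ge0 ?sqrtr_ge0//.
  have n1 : 1 <= Num.sqrt n%:R `^ e :> R.
    have one : 1 `^ e = 1 :> R by rewrite powR1.
    have s1 : 1 <= Num.sqrt n%:R :> R.
      by rewrite -[leLHS]sqrtr1 ler_sqrt ?ler1n//; exact: leq_ltn_trans Nn.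
    by rewrite -[leLHS]one ge0_ler_powR ?nnegrE ?sqrtr_ge0.
  apply: (@le_trans _ _ (2 `^ (- (n%:R * g)) `^ e)); last by rewrite ler_peMr ?powR_ge0.
  have -> : 2 `^ (- (n%:R * (g * p))) = 2 `^ (- (n%:R * (g * (p - e)))) * (2 `^ (- (n%:R * g))) `^ e :> R.
    rewrite -powRrM -powRD; last by apply/implyP.
    by congr (_ `^ _); ring.
  by rewrite mulrA ler_piMl ?powR_ge0.
have [D D0 hD] := delta_bounded.
have De : 0 < D `^ e by rewrite powR_gt0.
have gb : 0 < g * p by rewrite mulr_gt0.
have [N hN] := Orate_eventually_le gb De (rate _).
exists N.+1 => n Nn; apply: (le_trans (ler_norm _)); apply: (le_trans (hN n (ltnW Nn))).
have d0 : 0 < delta H n.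
  by rewrite deltaE mulr_gt0 ?powR_gt0// sqrtr_gt0 ltr0n; exact: leq_ltn_trans Nn.
rewrite -[e]opprK powRN [leRHS]powRN lef_pV2 ?posrE ?powR_gt0//.
by rewrite ge0_ler_powR ?nnegrE ?oppr_ge0 ?(ltW e0) ?(ltW d0) ?(ltW D0).
Qed.

End Delta.

(** * The estimate along one path *)

Section PathRate.
Context {R : realType} {disp : measure_display} {Omega : measurableType disp}.
Variables (d K : nat) (T H : R) (B : R -> Omega -> 'cV[R]_K) (w : Omega).
Variables (u : R -> 'cV[R]_d -> 'cV[R]_d) (sigma : 'cV[R]_d -> 'M[R]_(d, K)).
Variables (y : R -> 'cV[R]_d) (p : R).
Hypothesis T0 : 0 < T.
Hypothesis H13 : 3^-1 < H < 1.
Hypothesis p0H : 0 < p < H.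
Hypothesis adm : admissible_coefficients T H u sigma.
Hypothesis hB : forall a : R, 0 < a < H -> holder T a (B ^~ w).
Hypothesis hy : forall a : R, (if H <= 2^-1 then 3^-1 < a < H else 2^-1 < a < H) ->
  holder T a y /\ holder2 T (2 * a) (remainder1 u sigma (B ^~ w) y).
Hypothesis bsr : forall k l, exists C : R, forall n,
  blocksum T H B (pair_coef k l) n w <=
    C * 2 `^ (- (n%:R * ((1 - hmax H) * p))) * variation_scale T H n.
Hypothesis snz : exists2 t : R, 0 <= t <= T & sigma (y t) != 0.

Let beta := (1 - hmax H) * p.

Let exponents : exists a g : R, [/\ (if H <= 2^-1 then 3^-1 < a < H else 2^-1 < a < H),
   p <= a & [/\ beta <= a + g - 2 * H, beta <= 2 * g - 2 * H & [/\ 0 < g, g <= 2 * a & g <= 1]]].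
Proof.
(* All constraints on a are lower bounds smaller than H. *)
have fin_max (l1 l2 l3 : R) : l1 < H -> l2 < H -> l3 < H ->
    exists a, [/\ a < H, l1 < a, l2 < a & l3 < a].
  move=> h1 h2 h3; exists ((Num.max l1 (Num.max l2 l3) + H) / 2).
  have m1 : l1 <= Num.max l1 (Num.max l2 l3) by rewrite le_max lexx.
  have m2 : l2 <= Num.max l1 (Num.max l2 l3) by rewrite !le_max lexx orbT.
  have m3 : l3 <= Num.max l1 (Num.max l2 l3) by rewrite !le_max lexx !orbT.
  have mH : Num.max l1 (Num.max l2 l3) < H by rewrite !gt_max h1 h2 h3.
  by split; lra.
case/andP: H13 => H3 H1; case/andP: p0H => p0 pH.
rewrite /beta /hmax; have [h|h] := leP H 2^-1.
  have [||| a [aH a1 a2 a3]] := fin_max p 3^-1 ((2 * H + (1 - 2^-1) * p) / 3); try lra.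
  exists a, (2 * a); split; [by rewrite a2 aH|exact: ltW|split; [lra|lra|split; lra]].
have hb : (1 - H) * p < 1 - H by rewrite gtr_pMr; lra.
have [||| a [aH a1 a2 a3]] := fin_max p 2^-1 (2 * H - 1 + (1 - H) * p); try lra.
exists a, 1; split; [by rewrite a2 aH|exact: ltW|split; [lra|lra|split; lra]].
Qed.

(** The coefficients [sigma(y)] inherit the Hoelder regularity of [y] since
    [sigma] is Lipschitz on a box containing the path, and the remainder of the
    equation plus the drift bounds [y - sigma(y) dB] on each interval. *)
Lemma path_rate : exists N (C : R), forall n, (N <= n)%N ->
  `|H - hurst_estimator T y n| <= C * 2 `^ (- (n%:R * beta)).
Proof.
have [a [g [ha pa [b1 b2 [g0 g2 g1]]]]] := exponents.
have H01 : 0 < H < 1 by case/andP: H13 => h1 h2; rewrite h2 andbT; lra.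
have /andP[gm0 gm1] := hmax_itv H01.
have aH : 0 < a < H.
  by move: ha; case: ifP => _ /andP[h1 ->]; rewrite andbT; lra.
have a0 : 0 < a by case/andP: aH.
have [hya hrem] := hy ha.
have [MB MB0 [_ hMB]] := holder_bound T0 (hB aH).
have [My My0 [hyb hyh]] := holder_bound T0 hya.
have [Mr Mr0 hMr] := holder2_bound hrem.
have [Md Md0 hMd] := drift_bound T0 a0 hya adm.1.
have C1 i k : class_C 1 (fun x => sigma x i k).
  have := adm.2 i k; case: ifP => // _ [cf hf]; split => // j.
  by have [df [cp _]] := hf j.
have hyi t i : 0 <= t <= T -> `|y t i 0| <= My.
  by move=> tT; rewrite (le_trans (mx_entry_le _ _ _))// hyb.
have lip i k : exists L : R, 0 <= L /\ forall x z : 'cV[R]_d,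
    (forall i, `|x i 0| <= My) -> (forall i, `|z i 0| <= My) ->
    `|sigma x i k - sigma z i k| <= L * `|x - z|.
  by have [L L0 hL] := class_C1_lipschitz My (C1 i k); exists L.
have bnd i k : exists L : R, 0 <= L /\ forall x : 'cV[R]_d,
    (forall i, `|x i 0| <= My) -> `|sigma x i k| <= L.
  by have [L L0 hL] := continuous_box_bounded My (C1 i k).1; exists L.
have {lip} [L1 hL1] := choice (fun ik : 'I_d * 'I_K => lip ik.1 ik.2).
have {bnd} [L2 hL2] := choice (fun ik : 'I_d * 'I_K => bnd ik.1 ik.2).
pose Ls := \sum_ik (L1 ik * My) + \sum_ik L2 ik.
have Ls1 ik : L1 ik * My <= Ls.
  rewrite /Ls (bigD1 ik)//= -addrA lerDl addr_ge0// sumr_ge0// => jk _.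
    by rewrite mulr_ge0//; have [] := hL1 jk.
  by have [] := hL2 jk.
have Ls2 ik : L2 ik <= Ls.
  rewrite /Ls [X in _ + X](bigD1 ik)//= addrCA lerDl addr_ge0// sumr_ge0// => jk _.
    by rewrite mulr_ge0//; have [] := hL1 jk.
  by have [] := hL2 jk.
have Ls0 : 0 <= Ls.
  rewrite /Ls addr_ge0// sumr_ge0// => jk _.
    by rewrite mulr_ge0//; have [] := hL1 jk.
  by have [] := hL2 jk.
(* The mesh is at most T, so its higher powers are bounded by its g-th power. *)
pose Me := Mr * T `^ (2 * a - g) + Md * T `^ (1 - g).
have Me0 : 0 <= Me by rewrite addr_ge0// mulr_ge0// powR_ge0.
pose M := Ls + MB + Me.
have M0 : 0 <= M by rewrite /M; lra.
have mesh_split x n : g <= x -> mesh T n `^ x <= T `^ (x - g) * mesh T n `^ g.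
  move=> gx; have mg := mesh_gt0 T0 n.
  have -> : mesh T n `^ x = mesh T n `^ (x - g) * mesh T n `^ g.
    by rewrite -powRD ?subrK//; apply/implyP => _; rewrite gt_eqF.
  rewrite ler_wpM2r ?powR_ge0// ge0_ler_powR ?nnegrE ?subr_ge0 ?(ltW mg) ?(ltW T0)//.
  exact: mesh_le_T.
have dyn n i : (i < 2 ^ n)%N -> [/\ 0 <= dyadic T n i, dyadic T n i < dyadic T n i.+1,
    dyadic T n i.+1 <= T & dyadic T n i.+1 - dyadic T n i = mesh T n].
  move=> hi; have /andP[_ h2] := dyadic_in_itv T0 hi.
  have /andP[h1 _] := dyadic_in_itv T0 (ltnW hi).
  have h3 : dyadic T n i.+1 - dyadic T n i = mesh T n.
    by rewrite !dyadicE -mulrBl -[i.+1%:R]natr1 addrAC subrr add0r mul1r.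
  split => //; have := mesh_gt0 T0 n; lra.
apply: (@hurst_rate R disp Omega d K T H B w y (fun t => sigma (y t)) a g beta M T0 H01 a0 _ M0) => //.
- by rewrite mulr_gt0//; case/andP: p0H.
- by rewrite ler_wpM2l// ltW.
- move=> t r k tT; have [_ /(_ (y t) (fun i => hyi t i tT)) h] := hL2 (r, k).
  by rewrite (le_trans h)// (le_trans (Ls2 (r, k)))// /M; lra.
- move=> s t r k s0 st tT.
  have sT : 0 <= s <= T by rewrite s0 (le_trans st).
  have tT' : 0 <= t <= T by rewrite (le_trans s0 st).
  have [l0 /(_ (y t) (y s) (fun i => hyi t i tT') (fun i => hyi s i sT)) h] := hL1 (r, k).
  rewrite (le_trans h)//.
  apply: (@le_trans _ _ (L1 (r, k) * My * (t - s) `^ a)).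
    by rewrite -mulrA ler_wpM2l// hyh.
  rewrite ler_wpM2r ?powR_ge0// (le_trans (Ls1 (r, k)))// /M; lra.
- move=> n i k /dyn[d1 d2 d3 d4].
  rewrite (le_trans (mx_entry_le _ _ _))// /incr.
  rewrite (le_trans (hMB _ _ d1 (ltW d2) d3))// d4 ler_wpM2r ?powR_ge0// /M; lra.
- move=> n i r /dyn[d1 d2 d3 d4].
  set s := dyadic T n i in d1 d2 d4 *; set t := dyadic T n i.+1 in d2 d3 d4 *.
  have -> : incr y s t r 0 - \sum_(k < K) sigma (y s) r k * incr (B ^~ w) s t k 0 =
     remainder1 u sigma (B ^~ w) y s t r 0 + drift u y s t r 0.
    rewrite /remainder1 [RHS]addrC !mxE; ring.
  rewrite (le_trans (ler_normD _ _))//.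
  have e1 := hMr s t d1 d2 d3; have e2 := hMd s t r d1 (ltW d2) d3.
  have e3 := le_trans (mx_entry_le _ r 0) e1.
  rewrite d4 in e2 e3.
  have f1 := ler_wpM2l Mr0 (mesh_split (2 * a) n g2).
  have f2 := ler_wpM2l Md0 (mesh_split 1 n g1).
  rewrite powRr1 ?(ltW (mesh_gt0 T0 n))// in f2.
  have f3 : 0 <= mesh T n `^ g := powR_ge0 _ _.
  apply: (@le_trans _ _ (Me * mesh T n `^ g)); first by rewrite /Me; lra.
  by rewrite ler_wpM2r// /M; lra.
Qed.

End PathRate.

(** * Almost sure convergence of the estimator *)

Theorem theorem5p1 (R : realType) (d K : nat) (H eps : R) :
  3^-1 < H < 1 -> 0 < eps ->
  exists C : R -> \bar R -> \bar R -> \bar R -> R,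
  forall (T : R) (disp : measure_display) (Omega : measurableType disp)
    (P : probability Omega R)
    (B : R -> Omega -> 'cV[R]_K) (BB : R -> R -> Omega -> 'M[R]_K)
    (Theta : Type) (theta : Theta)
    (u : R -> 'cV[R]_d -> 'cV[R]_d) (sigma : 'cV[R]_d -> Theta -> 'M[R]_(d, K))
    (y : R -> Omega -> 'cV[R]_d),
  0 < T ->
  fractional_brownian_motion P T H B ->
  (H <= 2^-1 -> rough_lift P T H B BB) ->
  admissible_coefficients T H u (sigma ^~ theta) ->
  pathwise_solution P T H B BB u (sigma ^~ theta) y ->
  {ae P, forall w,
    (* y' is not identically 0 on [0, T]: where it is, y solves dy = u(y) dt
       and H_n tends to 1 (or S_n = 0 / 0) whatever H is *)
    (exists2 t : R, 0 <= t <= T & sigma (y t w) theta != 0) ->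
    exists n0 : nat, forall n : nat, (n0 <= n)%N ->
      `|H - hurst_estimator T (y ^~ w) n| <=
      C T (holder_norm T (H - eps) (B ^~ w))
          (holder_norm T (H - eps) (fun t => sigma (y t w) theta))
          (holder_seminorm2 T (2 * (H - eps))
             (y_sharp (sigma ^~ theta) (B ^~ w) (y ^~ w)))
      * delta H n `^ (H - eps)}.
Proof.
move=> H13 eps0; exists (fun _ _ _ _ => 1).
move=> T disp Omega P B BB Theta theta u sigma y T0 fB _ adm sol.
have H01 : 0 < H < 1 by case/andP: H13 => h1 h2; rewrite h2 andbT; lra.
have H0 : 0 < H by case/andP: H01.
have /andP[gm0 gm1] := hmax_itv H01.
(* An exponent with 0 < p < H and H - eps < p. *)
pose p := (Num.max 0 (H - eps) + H) / 2.
have m1 : 0 <= Num.max 0 (H - eps) by rewrite le_max lexx.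
have m2 : H - eps <= Num.max 0 (H - eps) by rewrite le_max lexx orbT.
have m3 : Num.max 0 (H - eps) < H by rewrite gt_max H0 gtrBl.
have p0H : 0 < p < H by rewrite /p; lra.
have ep : H - eps < p by rewrite /p; lra.
pose beta := (1 - hmax H) * p.
have beta_lt : beta < hmax H * (1 - hmax H).
  rewrite /beta mulrC ltr_pM2r//; case/andP: p0H => _ pH.
  by rewrite (lt_le_trans pH)// /hmax le_max lexx orbT.
have rates : {ae P, forall w, forall k l : 'I_K, exists C : R, forall n,
    blocksum T H B (pair_coef k l) n w <= C * 2 `^ (- (n%:R * beta)) * variation_scale T H n}.
  apply: filter_forall => k; apply: filter_forall => l.
  apply: (blocksum_rate T0 H01 fB _ beta_lt).
  by rewrite pair_coef_sq ltr_pwDl// mulr_ge0.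
case: fB => _ _ hold.
near=> w => snz.
have hB : forall a : R, 0 < a < H -> holder T a (B ^~ w) by near: w.
have hs : forall a : R,
    (if H <= 2^-1 then 3^-1 < a < H else 2^-1 < a < H) ->
    [/\ holder T a (y ^~ w),
        holder2 T (2 * a) (remainder1 u (sigma ^~ theta) (B ^~ w) (y ^~ w))
      & H <= 2^-1 ->
        holder2 T (3 * a)
          (remainder2 u (sigma ^~ theta) (B ^~ w) (fun s t => BB s t w) (y ^~ w))].
  by near: w; exact: sol.
have hr : forall k l : 'I_K, exists C : R, forall n,
    blocksum T H B (pair_coef k l) n w <= C * 2 `^ (- (n%:R * beta)) * variation_scale T H n.
  by near: w.
have hy a : (if H <= 2^-1 then 3^-1 < a < H else 2^-1 < a < H) ->
    holder T a (y ^~ w) /\ holder2 T (2 * a) (remainder1 u (sigma ^~ theta) (B ^~ w) (y ^~ w)).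
  by move=> /hs[].
have [N1 [C hC]] := path_rate T0 H13 p0H adm hB hy hr snz.
have p0 : 0 < p by case/andP: p0H.
have [N2 hN2] := rate_le_delta H01 C p0 ep.
exists (maxn N1 N2) => n; rewrite geq_max => /andP[n1 n2].
by rewrite mul1r (le_trans (hC n n1))// hN2.
Unshelve. all: by end_near. Qed.
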